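(* Let $n\ge 3$, $G=\mathrm{SL}_n(\mathbb{R})$, $\Gamma=\mathrm{SL}_n(\mathbb{Z})$, and let $A\subset G$ be the group of diagonal matrices with positive diagonal entries, acting on $G/\Gamma$ by left translations. The following assertions are equivalent: \begin{itemize} \item[(M)] Any $A$-orbit on $G/\Gamma$ which is bounded (i.e. has compact closure) is closed (and hence compact). \item[(a)] Any compact minimal set for the $A$-action on $G/\Gamma$ is a compact $A$-orbit. \item[(b)] For any root $\alpha$ and any compact $A$-minimal set $Y\subset G/\Gamma$, $Y$ is also minimal for the action of $A_\alpha$. \item[(c)] For any root $\alpha$ and any compact $A$-minimal set $Y\subset G/\Gamma$, any $A_\alpha$-minimal subset $Y_\alpha\subset Y$ satisfies $AY_\alpha=Y$. \item[(d)] For any root $\alpha$ and any compact $A$-minimal set $Y\subset G/\Gamma$, there exists an $A_\alpha$-minimal subset $Y_\alpha\subset Y$ such that $AY_\alpha=Y$. \end{itemize}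
   Context: For a group $B$ acting on a locally compact space $X$, a nonempty subset $Y\subset X$ is a minimal set for $B$ (or $B$-minimal) if it is closed and $B$-invariant and every $B$-orbit in $Y$ is dense in $Y$. Let $\mathbb{R}^*$ denote the multiplicative group of positive real numbers and $\mathfrak{g}=\mathrm{Lie}(G)$. A root is a nontrivial homomorphism $\alpha:A\to\mathbb{R}^*$ for which there is a nonzero $\mathbf{v}\in\mathfrak{g}$ with $\mathrm{Ad}(a)\mathbf{v}=\alpha(a)\mathbf{v}$ for all $a\in A$. For a root $\alpha$, $A_\alpha=\ker\alpha\subset A$. *)

(* Defs.v *)
From HB Require Import structures.
From mathcomp Require Import all_boot all_order all_algebra.
From mathcomp Require Import all_classical all_reals all_analysis.
Set Implicit Arguments.
Unset Strict Implicit.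
Unset Printing Implicit Defensive.
Import Order.TTheory GRing.Theory Num.Theory.
Import numFieldNormedType.Exports.
Local Open Scope classical_set_scope.
Local Open Scope quotient_scope.
Local Open Scope ring_scope.

Section Minimality.
Context {T : Type} {X : topologicalType} (act : T -> X -> X).

Definition orbit_of (B : set T) (x : X) : set X := [set act b x | b in B].

(* As the orbits of points of [Y] stay in [Y], [Y `<=` closure _] is density
   of the orbit in [Y]. *)
Definition minimal_set (B : set T) (Y : set X) : Prop :=
  [/\ Y !=set0, closed Y,
      (forall b y, B b -> Y y -> Y (act b y)) &
      (forall y, Y y -> Y `<=` closure (orbit_of B y))].

End Minimality.

Record SL (R : comUnitRingType) (n : nat) :=
  MkSL { SL_mx :> 'M[R]_n ; _ : \det SL_mx == 1 }.

HB.instance Definition _ R n := [isSub for @SL_mx R n].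
HB.instance Definition _ R n := [Choice of SL R n by <:].

Section SLGroup.
Context {R : comUnitRingType} {n : nat}.
Implicit Types g h : SL R n.

Lemma SL_det g : \det g = 1.
Proof. by case: g => ? /= /eqP. Qed.

Lemma SL_unitmx g : (g : 'M[R]_n) \in unitmx.
Proof. by rewrite unitmxE SL_det unitr1. Qed.

Fact SL_mul_subproof g h : \det (g *m h) == 1.
Proof. by rewrite det_mulmx !SL_det mulr1. Qed.

Fact SL_one_subproof : \det (1%:M : 'M[R]_n) == 1.
Proof. by rewrite det1. Qed.

Fact SL_inv_subproof g : \det (invmx g) == 1.
Proof. by rewrite det_inv SL_det invr1. Qed.

Definition SL_mul g h : SL R n := MkSL (SL_mul_subproof g h).
Definition SL_one : SL R n := MkSL SL_one_subproof.
Definition SL_inv g : SL R n := MkSL (SL_inv_subproof g).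

Fact SL_mulA : associative SL_mul.
Proof. by move=> a b c; apply/val_inj/mulmxA. Qed.
Fact SL_mul1 : left_id SL_one SL_mul.
Proof. by move=> a; apply/val_inj/mul1mx. Qed.
Fact SL_mulr1 : right_id SL_one SL_mul.
Proof. by move=> a; apply/val_inj/mulmx1. Qed.
Fact SL_mulV : left_inverse SL_one SL_inv SL_mul.
Proof. by move=> a; apply/val_inj/mulVmx/SL_unitmx. Qed.
Fact SL_mulrV : right_inverse SL_one SL_inv SL_mul.
Proof. by move=> a; apply/val_inj/mulmxV/SL_unitmx. Qed.

HB.instance Definition _ :=
  isGroup.Build (SL R n) SL_mulA SL_mul1 SL_mulr1 SL_mulV SL_mulrV.

Lemma SL_mxM g h : SL_mx (g * h)%g = g *m h. Proof. by []. Qed.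
Lemma SL_mx1 : SL_mx (1%g : SL R n) = 1%:M. Proof. by []. Qed.
Lemma SL_mxV g : SL_mx (g^-1)%g = invmx g. Proof. by []. Qed.

End SLGroup.

HB.instance Definition _ (R : realType) n :=
  Topological.copy (SL R n) (initial_topology (@SL_mx R n)).

Section Quotient.
Context (R : realType) (n : nat).

Definition SLZ : {pred SL R n} :=
  fun g => [forall i, forall j, SL_mx g i j \is a Num.int].

Lemma SLZP (g : SL R n) :
  reflect (forall i j, SL_mx g i j \is a Num.int) (g \in SLZ).
Proof. exact: 'forall_forallP. Qed.

Fact SLZ_group_closed : group_closed SLZ.
Proof.
split=> [|g h /SLZP gZ /SLZP hZ].
  by apply/SLZP => i j; rewrite SL_mx1 mxE; case: eqP.
apply/SLZP => i j; rewrite SL_mxM mxE rpred_sum// => k _.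
rewrite rpredM// SL_mxV /invmx SL_unitmx SL_det invr1 scale1r mxE /cofactor.
rewrite rpredM ?rpredX ?rpredN1// rpred_sum// => s _.
by rewrite rpredM ?rpredX ?rpredN1// rpred_prod// => l _; rewrite !mxE.
Qed.

(* [g] and [h] span the same left coset of SL_n(Z). *)
Definition SLZ_coset_rel (g h : SL R n) : bool := (g^-1 * h)%g \in SLZ.

Fact SLZ_coset_equiv : equiv_class_of SLZ_coset_rel.
Proof.
have SV := group_closedV SLZ_group_closed.
have SM := group_closedM SLZ_group_closed.
split; rewrite /SLZ_coset_rel.
- by move=> g; rewrite mulVg; case: SLZ_group_closed.
- by move=> g h; apply/idP/idP => /SV; rewrite invgM invgK.
- by move=> h g k gh hk; have := SM _ _ gh hk; rewrite -mulgA mulVKg.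
Qed.

Canonical SLZ_coset_equiv_rel := EquivRelPack SLZ_coset_equiv.

Definition SL_mod_SLZ := quotient_topology {eq_quot SLZ_coset_rel}.
HB.instance Definition _ := Topological.on SL_mod_SLZ.
HB.instance Definition _ := Quotient.on SL_mod_SLZ.

Definition coset_SLZ (g : SL R n) : SL_mod_SLZ := \pi_SL_mod_SLZ g.

Definition pos_diag : {pred SL R n} :=
  fun g => is_diag_mx g && [forall i, 0 < SL_mx g i i].

Lemma pos_diagP (g : SL R n) :
  reflect ((forall i j, i != j -> SL_mx g i j = 0) /\
           (forall i, 0 < SL_mx g i i)) (g \in pos_diag).
Proof.
apply: (iffP andP) => -[gd gp]; split.
- by move=> i j ij; apply/is_diag_mxP.
- exact/forallP.
- by apply/is_diag_mxP => i j; exact: gd.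
- exact/forallP.
Qed.

Fact pos_diag_group_closed : group_closed pos_diag.
Proof.
split=> [|g h /pos_diagP[gd gp] /pos_diagP[hd hp]].
  apply/pos_diagP; rewrite SL_mx1; split=> [i j /negPf ij|i].
    by rewrite mxE ij.
  by rewrite mxE eqxx ltr01.
have entry i j : SL_mx g i j = SL_mx (g / h)%g i j * SL_mx h j j.
  rewrite -{1}(mulgVK h g) SL_mxM mxE (bigD1 j)//= big1 ?addr0// => k kj.
  by rewrite (hd k j)// mulr0.
apply/pos_diagP; split=> [i j ij|i].
  have := entry i j; rewrite (gd _ _ ij) => /esym/eqP.
  by rewrite mulf_eq0 (gt_eqF (hp j)) orbF => /eqP.
by have := gp i; rewrite entry pmulr_lgt0.
Qed.

Record diagA := MkDiagA { diagA_val :> SL R n ; _ : diagA_val \in pos_diag }.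

HB.instance Definition _ := [isSub for diagA_val].
HB.instance Definition _ := [Choice of diagA by <:].
HB.instance Definition _ :=
  SubChoice_isSubGroup.Build (SL R n) pos_diag diagA pos_diag_group_closed.

Definition diagA_act (a : diagA) (x : SL_mod_SLZ) : SL_mod_SLZ :=
  coset_SLZ (diagA_val a * repr x)%g.

Lemma coset_SLZP (g h : SL R n) :
  reflect (coset_SLZ g = coset_SLZ h) ((g^-1 * h)%g \in SLZ).
Proof.
by apply: (iffP idP) => [gh|/(@eqmodP _ SLZ_coset_equiv_rel)//];
  apply/(@eqmodP _ SLZ_coset_equiv_rel).
Qed.

Lemma coset_SLZ_repr (x : SL_mod_SLZ) : coset_SLZ (repr x) = x.
Proof. exact: reprK. Qed.

Lemma diagA_act_coset (a : diagA) (g : SL R n) :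
  diagA_act a (coset_SLZ g) = coset_SLZ (diagA_val a * g)%g.
Proof.
apply/coset_SLZP; rewrite invgM -mulgA mulKg; apply/coset_SLZP.
exact: coset_SLZ_repr.
Qed.

Lemma diagA_act1 (x : SL_mod_SLZ) : diagA_act 1%g x = x.
Proof.
rewrite -{2}(coset_SLZ_repr x) /diagA_act.
by rewrite (_ : diagA_val 1%g = 1%g)// mul1g.
Qed.

Lemma diagA_actM (a b : diagA) (x : SL_mod_SLZ) :
  diagA_act (a * b)%g x = diagA_act a (diagA_act b x).
Proof.
rewrite -(coset_SLZ_repr x) !diagA_act_coset.
by rewrite (_ : diagA_val (a * b)%g = diagA_val a * diagA_val b)%g// mulgA.
Qed.

Definition Ad (g : SL R n) (v : 'M[R]_n) : 'M[R]_n :=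
  SL_mx g *m v *m SL_mx (g^-1)%g.

(* The Lie algebra of SL_n(R) is the space of trace-zero matrices. No
   continuity is required of [alpha]: it follows from the eigenvector. *)
Definition is_root (alpha : diagA -> R) : Prop :=
  [/\ (forall a, 0 < alpha a),
      (forall a b, alpha (a * b)%g = alpha a * alpha b),
      (exists a, alpha a != 1) &
      (exists v : 'M[R]_n, [/\ v != 0, \tr v = 0 &
         forall a : diagA, Ad a v = alpha a *: v])].

Definition root_ker (alpha : diagA -> R) : set diagA :=
  [set a | alpha a = 1].

Definition compact_A_minimal (Y : set SL_mod_SLZ) : Prop :=
  compact Y /\ minimal_set diagA_act setT Y.

End Quotient.

(* Main.v *)
Require Import Defs.
From mathcomp Require Import all_boot all_order all_algebra.
From mathcomp Require Import all_classical all_reals all_analysis.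
From mathcomp Require Import perm ring lra zify.
Set Implicit Arguments.
Unset Strict Implicit.
Unset Printing Implicit Defensive.
Import Order.TTheory GRing.Theory Num.Theory.
Import numFieldNormedType.Exports.
Local Open Scope classical_set_scope.

(** The dynamics is read off the lattices [g Z^n].  A compact set [K] that is
    invariant under [A] contains no lattice with a nonzero vector that has a
    zero coordinate ([lattice_entry_neq0]): contracting the other coordinates
    by [A] would make that vector arbitrarily short.  Hence no point of [K] can
    be moved within [K] by a whole ray of elementary matrices
    [1 + r s E_ij], [0 < r] ([shear_ray_escapes]): for some [r] such a matrix
    cancels the [i]-th coordinate of a lattice vector.

    Rays of shears are produced as follows.  If points of [Y] are moved within
    [K] by elements outside [A] that tend to the identity, then renormalization
    by [A] yields in the limit one shear [1 + t E_ij], [t] nonzero, that moves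
    a point of [Y] within [K] ([transverse_return_shear]).  When [K = Y] is
    [A]-minimal and is swept out by [A] from a subset [Y0] on which an element
    of the group [A U_ij] that moves one point of [Y0] into [Y0] moves all of
    them into [Y0], a single shear within [Y] entails a ray of them, so there
    is none ([no_shear_return]).  This applies in two situations.

    If [Y0] is a minimal set for the kernel of the root [a_i / a_j], the
    hypothesis on [Y0] holds because that kernel commutes with [A U_ij]; so (d)
    implies that [Y] has no transverse returns, that is, that [Y] is a single
    orbit ([root_minimal_spread_orbit]).

    If [Y = A y] is a compact orbit, one may take [Y0 = {y}].  So [Y] returns
    to itself near the identity only along [A], and recurrence gives elements
    of the stabilizer of [y] in [A] close to any long displacement that recurs.
    Taking displacements with [a_i = a_j] and the other entries far apart, one
    finds stabilizer elements with [a_i / a_j] near [1] but, by an argument on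
    characteristic polynomials that uses [3 <= n], not equal to [1].  So the
    values of [a_i / a_j] on the stabilizer are dense in the positive reals
    ([stabilizer_root_dense]).  This density yields that [Y] is minimal for the
    kernel of the root, which is (b), and that a shear of a point of [Y] in the
    closure of a bounded orbit spreads to a ray, so that a bounded orbit that
    accumulates on [Y] is [Y], which is (M).

    The implications from (b) to (c) and from (c) to (d) are formal, given that
    a compact invariant set contains a minimal set. *)

(** * Matrices: norm, compactness, continuity *)

Section MatrixNorm.
Local Open Scope ring_scope.
Context {R : realType}.

Lemma mx_entry_le m n (A : 'M[R]_(m, n)) i j : `|A i j| <= `|A|.
Proof.
rewrite [leRHS]/Num.norm /= mx_normrE.
by apply/bigmax_geP; right; exists (i, j).
Qed.

Lemma mx_norm_leP m n (A : 'M[R]_(m, n)) (c : R) : 0 <= c ->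
  reflect (forall i j, `|A i j| <= c) (`|A| <= c).
Proof.
move=> c0; apply: (iffP idP) => [Ac i j|Ac].
  exact: le_trans (mx_entry_le A i j) Ac.
rewrite [leLHS]/Num.norm /= mx_normrE.
by apply/bigmax_leP; split.
Qed.

Lemma mx_norm_ltP m n (A : 'M[R]_(m, n)) (c : R) : 0 < c ->
  reflect (forall i j, `|A i j| < c) (`|A| < c).
Proof.
move=> c0; apply: (iffP idP) => [Ac i j|Ac].
  exact: le_lt_trans (mx_entry_le A i j) Ac.
rewrite [ltLHS]/Num.norm /= mx_normrE.
by apply/bigmax_ltP; split.
Qed.

Lemma mx_norm_mul m n p (A : 'M[R]_(m, n)) (B : 'M[R]_(n, p)) :
  `|A *m B| <= n%:R * (`|A| * `|B|).
Proof.
apply/mx_norm_leP; first by rewrite !mulr_ge0.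
move=> i j; rewrite mxE; apply: le_trans (ler_norm_sum _ _ _) _.
rewrite -[X in X%:R * _](card_ord n) -sum1_card natr_sum mulr_suml.
apply: ler_sum => k _; rewrite mul1r normrM.
by rewrite ler_pM// mx_entry_le.
Qed.

Lemma mulmx_near m n p (A : 'M[R]_(m, n)) (B : 'M[R]_(n, p)) (e : R) :
  0 < e -> exists2 d : R, 0 < d &
    forall A' B', `|A' - A| < d -> `|B' - B| < d -> `|A' *m B' - A *m B| < e.
Proof.
move=> e0; pose k : R := n%:R * (`|A| + `|B| + 1) + 1.
have k0 : 0 < k by rewrite ltr_wpDl// mulr_ge0// !addr_ge0.
have ek0 : 0 < e / k by apply: divr_gt0.
exists (Num.min 1 (e / k)).
  by rewrite lt_min ltr01.
move=> A' B'; rewrite !lt_min => /andP[A1 Ae] /andP[B1 Be].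
have -> : A' *m B' - A *m B = (A' - A) *m B' + A *m (B' - B).
  by rewrite mulmxBl mulmxBr addrA subrK.
apply: le_lt_trans (ler_normD _ _) _.
have B'le : `|B'| <= `|B| + 1.
  rewrite -[B'](subrK B); apply: le_trans (ler_normD _ _) _.
  by rewrite addrC lerD2l ltW.
have -> : e = (k - 1) * (e / k) + e / k by field; rewrite gt_eqF.
apply: (@le_lt_trans _ _ ((k - 1) * (e / k))); last by rewrite ltrDl.
apply: le_trans (lerD (mx_norm_mul _ _) (mx_norm_mul _ _)) _.
rewrite -mulrDr /k addrK -mulrA ler_wpM2l//.
rewrite (_ : (_ + _ + 1) * _ = e / k * (`|B| + 1) + `|A| * (e / k)); last by ring.
by rewrite lerD// ler_pM// ltW.
Qed.

End MatrixNorm.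

Section CompactLimit.
Local Open Scope ring_scope.

(** The filter generated by the sets of points of [K] that satisfy [P] at some
    precision below [e] has a cluster point. *)
Lemma compact_limit (R : realType) (T : topologicalType) (K : set T)
    (P : R -> T -> Prop) : compact K ->
  (forall e, 0 < e -> exists x, K x /\ P e x) ->
  exists x0, K x0 /\ forall U e, nbhs x0 U -> 0 < e ->
    exists e' x, [/\ 0 < e' <= e, U x, K x & P e' x].
Proof.
move=> Kc KP.
pose B (e : R) := [set x | K x /\ exists2 e', 0 < e' <= e & P e' x].
pose F := filter_from [set e : R | 0 < e] B.
have FF : ProperFilter F.
  apply: filter_from_proper.
    apply: filter_from_filter; first by exists 1 => /=.
    move=> e f /= e0 f0; exists (Num.min e f) => /=; first by rewrite lt_min e0.
    move=> x [Kx [e' /andP[e'0]]]; rewrite le_min => /andP[e'e e'f] Pe'.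
    by split; split=> //; exists e' => //; rewrite e'0.
  move=> e /= e0; have [x [Kx Px]] := KP _ e0; exists x; split=> //.
  by exists e => //; rewrite e0 lexx.
have FK : F K by exists 1 => //= x [].
have [x0 [Kx0 cl]] := Kc F FF FK.
exists x0; split=> // U e Ux0 e0.
have [x [[Kx [e' ee' Px]] Ux]] := cl (B e) U (ex_intro2 _ _ e e0 (fun _ => id)) Ux0.
by exists e', x.
Qed.

End CompactLimit.

Section MatrixLimit.
Local Open Scope ring_scope.
Context {R : realType}.

Lemma mx_compact m n (C : R) : compact [set A : 'M[R]_(m, n) | `|A| <= C].
Proof.
have Sc : compact [set v : 'rV[R]_(m * n) |
    forall i, `[- C, C]%classic (v ord0 i)].
  by apply: (@rV_compact _ _ (fun=> `[- C, C]%classic)) => _;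
    apply: segment_compact.
have vc : continuous (@vec_mx R m n).
  move=> v U [V Vv VU].
  exists (fun=> mxvec (\matrix_(i, j) V i j) ord0) => [i k|w Ww].
    rewrite (ord1 i); case/mxvec_indexP: k => i0 j0.
    by rewrite mxvecE mxE; have := Vv i0 j0; rewrite mxE.
  apply: VU => i j; rewrite mxE.
  by have := Ww ord0 (mxvec_index i j); rewrite mxvecE mxE.
have := continuous_compact (continuous_subspaceT vc) Sc.
have [C0|C0] := leP 0 C; last first.
  move=> _; rewrite (_ : mkset _ = set0); first exact: compact0.
  by apply/seteqP; split=> A //= AC; have := le_trans (normr_ge0 A) AC; rewrite leNgt C0.
congr compact; apply/seteqP; split=> [A [v vC <-]|A /(mx_norm_leP _ C0) AC] /=.
  by apply/mx_norm_leP => // i j; rewrite mxE; have := vC (mxvec_index i j);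
  rewrite /= in_itv/= -ler_norml.
exists (mxvec A); last exact: mxvecK.
by case/mxvec_indexP=> i j /=; rewrite mxvecE in_itv/= -ler_norml.
Qed.

(** A Bolzano-Weierstrass principle for conditions [P e] indexed by a precision:
    it replaces the extraction of subsequences. *)
Lemma matrix_limit m n (C : R) (P : R -> 'M[R]_(m, n) -> Prop) :
  (forall e, 0 < e -> exists A, `|A| <= C /\ P e A) ->
  exists A0, `|A0| <= C /\ forall e, 0 < e ->
    exists e' A, [/\ 0 < e' <= e, `|A - A0| < e & P e' A].
Proof.
move=> CP; have [A0 [A0C lim]] := compact_limit (@mx_compact m n C) CP.
exists A0; split=> // e e0.
have [|e' [A [ee' AU _ PA]]] := lim (ball A0 e) e _ e0.
  exact: nbhsx_ballx.
exists e', A; split=> //.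
by move: AU; rewrite -ball_normE /= distrC.
Qed.

Lemma continuous_det n : continuous (fun A : 'M[R]_n => \det A).
Proof.
have addc : continuous (fun x : R * R => x.1 + x.2) by exact: add_continuous.
have mulc : continuous (fun x : R * R => x.1 * x.2) by exact: mul_continuous.
have := @continuous_big R _ _ 0 xpredT addc 'M[R]_n (index_enum {perm 'I_n})
  (fun s A => (-1) ^+ s * \prod_i A i (s i)).
apply=> s _ A; apply: (@continuousM _ _ (fun=> (-1) ^+ s)).
  exact: cst_continuous.
have := @continuous_big R _ _ 1 xpredT mulc 'M[R]_n (index_enum 'I_n)
  (fun i A => A i (s i)).
by apply=> i _; exact: coord_continuous.
Qed.

End MatrixLimit.

(** * The action on the space of lattices *)

Section Translations.
Local Open Scope ring_scope.
Context {R : realType} {n : nat}.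
Local Notation G := (SL R n).
Local Notation X := (SL_mod_SLZ R n).
Implicit Types (g h k : G) (x y : X) (S K : set X).

(** On [A] this is [diagA_act], by conversion. *)
Definition translate h x : X := coset_SLZ (h * repr x)%g.

Lemma translate_coset h g : translate h (coset_SLZ g) = coset_SLZ (h * g)%g.
Proof.
apply/coset_SLZP; rewrite invgM -mulgA mulKg; apply/coset_SLZP.
exact: coset_SLZ_repr.
Qed.

Lemma translate1 x : translate 1%g x = x.
Proof. by rewrite -(coset_SLZ_repr x) translate_coset mul1g. Qed.

Lemma translateM h k x : translate (h * k)%g x = translate h (translate k x).
Proof. by rewrite -(coset_SLZ_repr x) !translate_coset mulgA. Qed.

Lemma translateK h : cancel (translate h) (translate h^-1%g).
Proof. by move=> x; rewrite -translateM mulVg translate1. Qed.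

Lemma SL_mul_near g h (e : R) : 0 < e -> exists2 d : R, 0 < d &
  forall g' h', `|SL_mx g' - SL_mx g| < d -> `|SL_mx h' - SL_mx h| < d ->
    `|SL_mx (g' * h')%g - SL_mx (g * h)%g| < e.
Proof.
move=> e0; have [d d0 H] := mulmx_near (SL_mx g) (SL_mx h) e0.
by exists d => // g' h'; exact: H.
Qed.

Definition near1 (e : R) h := `|SL_mx h - 1%:M| < e.

Lemma near1_1 e : 0 < e -> near1 e 1%g.
Proof. by move=> e0; rewrite /near1 SL_mx1 subrr normr0. Qed.

Lemma near1_le d e h : d <= e -> near1 d h -> near1 e h.
Proof. by move=> de hd; apply: lt_le_trans de. Qed.

Lemma near1M e : 0 < e -> exists2 d : R, 0 < d &
  forall h k, near1 d h -> near1 d k -> near1 e (h * k)%g.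
Proof.
move=> e0; have [d d0 H] := SL_mul_near 1%g 1%g e0.
by exists d => // h k hd kd; rewrite /near1 -SL_mx1 -[1%g]mulg1 H.
Qed.

Lemma near1V e : 0 < e -> exists2 d : R, 0 < d &
  forall h, near1 d h -> near1 e h^-1%g.
Proof.
move=> e0; pose k : R := n.+1%:R; have k0 : 0 < k by rewrite ltr0n.
pose d := Num.min 1 e / (2 * k).
have d0 : 0 < d by rewrite divr_gt0 ?lt_min ?ltr01 ?mulr_gt0.
exists d => // h hd; rewrite /near1.
(* This identity bounds the inverse by itself, without determinants. *)
have E : SL_mx h^-1%g - 1%:M = (1%:M - SL_mx h) *m SL_mx h^-1%g.
  by rewrite mulmxBl mul1mx -SL_mxM mulgV.
set F := SL_mx h^-1%g in E *.
have F1 : `|F| <= `|F - 1%:M| + 1.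
  rewrite -{1}[F](subrK 1%:M); apply: le_trans (ler_normD _ _) _.
  rewrite lerD2l; apply/mx_norm_leP => // i j.
  by rewrite mxE; case: eqP; rewrite ?normr1 ?normr0.
have H : `|(1%:M - SL_mx h) *m F| <= n%:R * (d * (`|F - 1%:M| + 1)).
  apply: le_trans (mx_norm_mul _ _) _; rewrite ler_wpM2l// ler_pM//.
  by rewrite distrC ltW.
rewrite -E in H *; set f := `|F - 1%:M| in H *.
have f0 : 0 <= f by exact: normr_ge0.
have nd : n%:R * d < Num.min 1 e / 2.
  have -> : Num.min 1 e / 2 = k * d by rewrite /d; field; rewrite gt_eqF.
  by rewrite ltr_pM2r// ltr_nat.
have nd0 : 0 <= n%:R * d by rewrite mulr_ge0// ltW.
have m1 : Num.min 1 e <= 1 by rewrite ge_min lexx.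
have m2 : Num.min 1 e <= e by rewrite ge_min lexx orbT.
move: H; rewrite mulrA => H; nra.
Qed.

Lemma near1_conj g e : 0 < e -> exists2 d : R, 0 < d &
  forall h, near1 d h -> near1 e (g * h * g^-1)%g.
Proof.
move=> e0.
have [d d0 Hd] := SL_mul_near g g^-1%g e0.
have [c c0 Hc] := SL_mul_near g 1%g d0.
exists c => // h hc; rewrite /near1 -SL_mx1 -(mulgV g).
apply: Hd; last by rewrite subrr normr0.
by rewrite -{2}(mulg1 g) Hc ?subrr ?normr0.
Qed.

(** This holds because the projection to the quotient is open: the preimage of
    this set is a union, over the lattice, of right translates of an open set. *)
Lemma nbhs_translate x e : 0 < e ->
  nbhs x [set translate h x | h in [set h | near1 e h]].
Proof.
move=> e0; rewrite nbhsE /=;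
exists [set translate h x | h in [set h | near1 e h]] => //.
split; last by exists 1%g; [exact: near1_1|exact: translate1].
pose g := repr x.
pose A := \bigcup_(c in [set c : G | c \in @SLZ R n])
  [set M : 'M[R]_n | `|M *m SL_mx (c * g^-1)%g - 1%:M| < e].
exists A.
  apply: bigcup_open => c _; rewrite openE => M /= MA.
  have e1 : 0 < e - `|M *m SL_mx (c * g^-1)%g - 1%:M| by rewrite subr_gt0.
  have [d d0 H] := mulmx_near M (SL_mx (c * g^-1)%g) e1.
  apply/nbhs_ballP; exists d => //= N; rewrite -ball_normE /= distrC => NM.
  have := H N (SL_mx (c * g^-1)%g) NM; rewrite subrr normr0 => /(_ d0) {}H.
  rewrite -(subrK (M *m SL_mx (c * g^-1)%g) (N *m _)) -addrA.
  by apply: le_lt_trans (ler_normD _ _) _; rewrite -ltrBrDr.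
apply/seteqP; split=> [k [c cZ kc]|k [h hn]].
  exists (k * (c * g^-1))%g; first exact: kc.
  by apply/esym/(coset_SLZP k); rewrite !mulgA mulVg mul1g -mulgA mulVg mulg1.
move=> /esym/(coset_SLZP k (h * g)%g) kc.
exists (k^-1 * (h * g))%g; first exact: kc.
change (is_true (near1 e (k * (k^-1 * (h * g) * g^-1))%g)).
by rewrite !mulgA mulgV mul1g -mulgA mulgV mulg1.
Qed.

Lemma closure_translateP S x : closure S x <->
  forall e, 0 < e -> exists2 h, near1 e h & S (translate h x).
Proof.
split=> [Sx e /(nbhs_translate x) /Sx [y [Sy [h hn hy]]]|H U].
  by exists h => //; rewrite hy.
rewrite nbhsE /= => -[V [[A Ao AV] Vx] VU].
have AVE k : A (SL_mx k) = V (coset_SLZ k) by exact: (congr1 (@^~ k) AV).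
have : A (SL_mx (repr x)) by rewrite AVE coset_SLZ_repr.
rewrite openE in Ao => /Ao /nbhs_ballP [d /= d0 dA].
have [e e0 He] := SL_mul_near 1%g (repr x) d0.
have [h hn Sh] := H _ e0; exists (translate h x); split=> //; apply: VU.
rewrite /translate -AVE.
apply: dA; rewrite -ball_normE /= distrC.
by rewrite -{2}[repr x]mul1g He ?subrr ?normr0.
Qed.

(** [k x] tends to [h x] when [k] tends to [h], since [k = (k h^-1) h]. *)
Lemma closed_translate K h x : closed K ->
  (forall e, 0 < e -> exists2 k, `|SL_mx k - SL_mx h| < e & K (translate k x)) ->
  K (translate h x).
Proof.
move=> Kc H; apply/Kc/closure_translateP => e e0.
have [d d0 Hd] := SL_mul_near h h^-1%g e0.
have [k kd Kk] := H _ d0; exists (k * h^-1)%g; last first.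
  by rewrite -translateM mulgVK.
by rewrite /near1 -SL_mx1 -(mulgV h) Hd ?subrr ?normr0.
Qed.

Lemma compact_translate K (P : R -> X -> Prop) : compact K ->
  (forall e, 0 < e -> exists2 x, K x & P e x) ->
  exists2 x0, K x0 & forall e, 0 < e -> exists e' h,
    [/\ 0 < e' <= e, near1 e h, K (translate h x0) & P e' (translate h x0)].
Proof.
move=> Kc KP.
have [x0 [Kx0 lim]] : exists x0, K x0 /\ forall U e, nbhs x0 U -> 0 < e ->
    exists e' x, [/\ 0 < e' <= e, U x, K x & P e' x].
  by apply: compact_limit => // e /KP [x]; exists x.
exists x0 => // e e0.
have [e' [y [ee' [h hn hy] Kh Ph]]] := lim _ e (nbhs_translate x0 e0) e0.
by exists e', h; rewrite hy.
Qed.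

End Translations.

(** * Diagonal elements and roots *)

Section Torus.
Local Open Scope ring_scope.
Context {R : realType} {n : nat}.
Local Notation G := (SL R n).
Local Notation A := (diagA R n).
Implicit Types (a b : A) (g h k : G).

Definition dentry a p : R := SL_mx (diagA_val a) p p.

Lemma dentry_gt0 a p : 0 < dentry a p.
Proof. by have /pos_diagP[_ gp] := valP a; exact: gp. Qed.

Lemma diagA_mx a : SL_mx (diagA_val a) = diag_mx (\row_p dentry a p).
Proof.
apply/matrixP => p q; rewrite !mxE; have [<-|pq] := eqVneq p q.
  by rewrite mulr1n.
by rewrite mulr0n; have /pos_diagP[g0 _] := valP a; exact: g0.
Qed.

Lemma dentryM a b p : dentry (a * b)%g p = dentry a p * dentry b p.
Proof.
rewrite {1}/dentry (_ : diagA_val (a * b)%g = (diagA_val a * diagA_val b)%g)//.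
rewrite SL_mxM diagA_mx mul_diag_mx !mxE; congr (_ * _).
Qed.

Lemma dentry1 p : dentry 1%g p = 1.
Proof. by rewrite /dentry (_ : diagA_val 1%g = 1%g)// SL_mx1 mxE eqxx. Qed.

Lemma dentryV a p : dentry a^-1%g p = (dentry a p)^-1.
Proof.
have a0 : dentry a p != 0 by rewrite gt_eqF ?dentry_gt0.
by apply: (mulfI a0); rewrite -dentryM !mulgV dentry1 divff.
Qed.

Lemma exists_diag (d : 'I_n -> R) : (forall p, 0 < d p) -> \prod_p d p = 1 ->
  exists a, forall p, dentry a p = d p.
Proof.
move=> d0 d1.
have D1 : \det (diag_mx (\row_p d p)) == 1.
  by apply/eqP; rewrite det_diag -[RHS]d1; apply: eq_bigr => p _; rewrite mxE.
have DA : MkSL D1 \in @pos_diag R n.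
  apply/pos_diagP; split=> [p q pq|p] /=; rewrite !mxE.
    by rewrite (negPf pq) mulr0n.
  by rewrite eqxx mulr1n.
by exists (MkDiagA DA) => p; rewrite /dentry /= !mxE eqxx mulr1n.
Qed.

(** Subtracting the sum of the weights makes the determinant [1] without
    extracting roots, and leaves every root a power of [2 ^ n]. *)
Lemma exists_dyadic (w : 'I_n -> int) : exists a,
  forall p, dentry a p = 2 ^ (n%:Z * w p - \sum_q w q).
Proof.
apply: exists_diag => [p|]; first by rewrite exprz_gt0.
have -> : \prod_p (2 : R) ^ (n%:Z * w p - \sum_q w q) =
    2 ^ \sum_p (n%:Z * w p - \sum_q w q).
  elim/big_rec2: _ => [|p x y _ ->]; rewrite ?expr0z// [RHS]expfzDr//.
rewrite big_split/= sumrN -mulr_sumr sumr_const card_ord.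
by rewrite -[(\sum_q w q) *+ n]mulr_natl natz subrr expr0z.
Qed.

Definition troot (i j : 'I_n) a : R := dentry a i / dentry a j.

Lemma troot_gt0 i j a : 0 < troot i j a.
Proof. by rewrite divr_gt0 ?dentry_gt0. Qed.

Lemma trootM i j a b : troot i j (a * b)%g = troot i j a * troot i j b.
Proof. by rewrite /troot !dentryM; field; rewrite !gt_eqF ?dentry_gt0. Qed.

Lemma troot1 i j : troot i j 1%g = 1.
Proof. by rewrite /troot !dentry1 divr1. Qed.

Lemma trootV i j a : troot i j a^-1%g = (troot i j a)^-1.
Proof. by rewrite /troot !dentryV invf_div invrK mulrC. Qed.

Lemma trootX i j a m : troot i j (a ^+ m)%g = troot i j a ^+ m.
Proof.
by elim: m => [|m IH]; rewrite ?expg0 ?expr0 ?troot1// expgS trootM IH exprS.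
Qed.

Lemma exists_dyadic_root (w : 'I_n -> int) : exists a,
  forall p q, troot p q a = 2 ^ (n%:Z * (w p - w q)).
Proof.
have [a aw] := exists_dyadic w; exists a => p q.
by rewrite /troot !aw invr_expz -expfzDr//; congr (_ ^ _); ring.
Qed.

Lemma diag_conj_entry a h p q :
  SL_mx (diagA_val a * h * (diagA_val a)^-1)%g p q = troot p q a * SL_mx h p q.
Proof.
have -> : (diagA_val a)^-1%g = diagA_val a^-1%g by [].
rewrite !SL_mxM !diagA_mx mul_diag_mx mul_mx_diag !mxE dentryV /troot.
by ring.
Qed.

End Torus.

(** * Shears *)

Section Unipotent.
Local Open Scope ring_scope.
Context {R : realType} {n : nat}.
Local Notation G := (SL R n).

Lemma det_transvection (i j : 'I_n) (t : R) : i != j ->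
  \det (1%:M + t *: delta_mx i j : 'M[R]_n) = 1.
Proof.
move=> ij; wlog ji : i j ij / (j < i)%N => [H|].
  case: (ltngtP j i) => [/H|ij'|/val_inj ji]; first exact.
    rewrite -det_tr linearD linearZ/= trmx1 trmx_delta; apply: H => //.
    by rewrite eq_sym.
  by rewrite ji eqxx in ij.
rewrite det_trig; last first.
  apply/is_trig_mxP => p q pq; rewrite !mxE.
  have -> : (p == q) = false by apply/eqP => pq'; rewrite pq' ltnn in pq.
  case: andP => [[/eqP pi /eqP qj]|_]; last by rewrite mulr0 addr0.
  by move: pq ji; rewrite pi qj; case: ltngtP.
apply: big1 => p _; rewrite !mxE eqxx.
have [->|] := eqVneq p i; rewrite ?(negPf ij) /= ?mulr0 ?addr0//.
Qed.

Variables (i j : 'I_n) (ij : i != j).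

Definition transvection (t : R) : G :=
  MkSL (introT eqP (det_transvection t ij)).

Lemma transvection_mx t : SL_mx (transvection t) = 1%:M + t *: delta_mx i j.
Proof. by []. Qed.

Lemma transvectionD s t :
  transvection (s + t) = (transvection s * transvection t)%g.
Proof.
apply: val_inj; rewrite /= mulmxDl mul1mx mulmxDr mulmx1.
rewrite -scalemxAl -scalemxAr mul_delta_mx_0 1?eq_sym// !scaler0 addr0.
by rewrite -addrA -scalerDl (addrC t).
Qed.

Lemma transvection0 : transvection 0 = 1%g.
Proof. by apply: val_inj; rewrite /= scale0r addr0. Qed.

Lemma transvectionN t : transvection (- t) = (transvection t)^-1%g.
Proof.
apply: (@mulgI _ (transvection t)).
by rewrite -transvectionD subrr transvection0 mulgV.
Qed.

Lemma transvection_conj (a : diagA R n) t :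
  (diagA_val a * transvection t * (diagA_val a)^-1)%g =
  transvection (troot i j a * t).
Proof.
apply: val_inj; apply/matrixP => p q.
rewrite diag_conj_entry !transvection_mx !mxE mulrDr; congr (_ + _).
  have [<-|] := eqVneq p q; last by rewrite mulr0.
  by rewrite /troot divff ?mul1r// gt_eqF ?dentry_gt0.
by case: eqP => [->|]; case: eqP => [->|]; rewrite /= ?mulr0// !mulr1.
Qed.

Lemma transvection_near s t :
  `|SL_mx (transvection s) - SL_mx (transvection t)| <= `|s - t|.
Proof.
rewrite !transvection_mx opprD addrACA subrr add0r -scalerBl.
apply/mx_norm_leP => // p q; rewrite !mxE.
by case: andP => _; rewrite ?mulr1// mulr0 normr0.
Qed.

End Unipotent.

(** * Lattice vectors over a compact invariant set *)

Section LatticeVectors.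
Local Open Scope ring_scope.
Context {R : realType} {n : nat}.
Local Notation G := (SL R n).
Local Notation X := (SL_mod_SLZ R n).
Local Notation act := (@diagA_act R n).
Implicit Types (g h k : G) (x y : X) (K : set X).

Definition A_invariant K := forall a x, K x -> K (act a x).

Definition integral_vec (v : 'cV[R]_n) := forall p, v p ord0 \is a Num.int.

Lemma dyadic_small (c e : R) : 0 < e ->
  exists m : nat, c * (2 ^+ m)^-1 < e.
Proof.
move=> e0; have := @upper_nthrootP R (c / e) _ (leqnn _).
set m := Num.bound _ => cm; exists m.
by rewrite ltr_pdivrMr ?exprn_gt0// mulrC -ltr_pdivrMr.
Qed.

Lemma integral_norm_ge1 v : integral_vec v -> v != 0 -> 1 <= `|v|.
Proof.
move=> vZ; apply: contraNT; rewrite -ltNge => /(mx_norm_ltP _ ltr01) v1.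
apply/eqP/matrixP => p q; rewrite (ord1 q) mxE; apply/eqP.
apply: contraT => vp; have := v1 p ord0; rewrite ltNge.
by rewrite norm_intr_ge1.
Qed.

Lemma integral_mul g v : g \in @SLZ R n -> integral_vec v -> integral_vec (SL_mx g *m v).
Proof.
by move=> /SLZP gZ vZ p; rewrite mxE rpred_sum// => q _; rewrite rpredM.
Qed.

(** A vector with a zero coordinate could be made arbitrarily short by
    contracting the others, but the lattices of a compact set have no
    arbitrarily short nonzero vector. *)
Lemma lattice_entry_neq0 K g v p : compact K -> A_invariant K ->
  K (coset_SLZ g) -> integral_vec v -> v != 0 -> (SL_mx g *m v) p ord0 != 0.
Proof.
move=> Kc KA Kg vZ v0; apply/eqP => gv0.
pose P e x := exists k w, [/\ x = coset_SLZ k, integral_vec w, w != 0 &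
  `|SL_mx k *m w| < e].
have short e : 0 < e -> exists2 x, K x & P e x.
  move=> e0; have [m me] := dyadic_small `|SL_mx g *m v| e0.
  have [a aE] := exists_dyadic (R := R) (fun q => (m * (q == p))%:Z).
  exists (act a (coset_SLZ g)); first exact: KA.
  exists (diagA_val a * g)%g, v; split=> //; first exact: translate_coset.
  rewrite SL_mxM -mulmxA diagA_mx mul_diag_mx.
  apply/mx_norm_ltP => // q r; rewrite (ord1 r) !mxE aE.
  have -> : \sum_(q0 < n) (m * (q0 == p))%:Z = m%:Z.
    rewrite (bigD1 p)//= eqxx muln1 big1 ?addr0// => s /negPf ->.
    by rewrite muln0.
  have [->|qp] := eqVneq q p.
    by move: gv0; rewrite mxE => ->; rewrite mulr0 normr0.
  rewrite muln0 mulr0 add0r normrM; apply: le_lt_trans me.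
  rewrite mulrC ler_pM//; last by rewrite -exprnN normfV gtr0_norm ?exprn_gt0.
  by have := mx_entry_le (SL_mx g *m v) q ord0; rewrite mxE.
have [x0 Kx0 lim] := compact_translate Kc short.
pose g0 := repr x0; pose c := `|SL_mx g0^-1%g|.
have [d d0 dV] := near1V (n := n) (@ltr01 R).
pose D : R := n%:R * (c * (n%:R * 2)) + 1.
have c0 : 0 <= c by exact: normr_ge0.
have D0 : 0 < D by rewrite ltr_wpDl// !mulr_ge0.
have e0 : 0 < Num.min d D^-1 by rewrite lt_min d0 invr_gt0.
have [e' [h [/andP[e'0 e'le] hn _ [k [w [hk wZ w0 kw]]]]]] := lim _ e0.
move: hk; rewrite /translate => /coset_SLZP; rewrite -/g0 => gZ.
set u := SL_mx ((h * g0)^-1 * k)%g *m w.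
have uZ : integral_vec u by exact: integral_mul.
have u0 : u != 0.
  apply: contraNneq w0 => u0; rewrite -[w]mul1mx -SL_mx1.
  rewrite -(mulVg ((h * g0)^-1 * k)%g) SL_mxM -mulmxA.
  by rewrite -/u u0 mulmx0.
have := integral_norm_ge1 uZ u0; rewrite leNgt => /negP; apply.
rewrite /u invgM -!mulgA !SL_mxM -!mulmxA.
apply: le_lt_trans (mx_norm_mul _ _) _.
have hV : `|SL_mx h^-1%g| <= 2.
  have := dV _ (near1_le _ hn); rewrite ge_min lexx => /(_ isT) hV.
  rewrite -[SL_mx _](subrK 1%:M); apply: le_trans (ler_normD _ _) _.
  rewrite -[2]/(1 + 1) lerD//; first exact: ltW.
  apply/mx_norm_leP => // q r.
  by rewrite mxE; case: eqP; rewrite ?normr1 ?normr0.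
have kw' : `|SL_mx k *m w| <= D^-1.
  apply: le_trans (ltW kw) _; apply: le_trans e'le _.
  by rewrite ge_min lexx orbT.
apply: (@le_lt_trans _ _ ((D - 1) * D^-1)); last first.
  by rewrite mulrBl mul1r mulfV ?gt_eqF// ltrBlDr ltrDl invr_gt0.
rewrite /D addrK -!mulrA ler_wpM2l// ler_wpM2l//.
apply: le_trans (mx_norm_mul _ _) _; rewrite ler_wpM2l//.
by rewrite ler_pM.
Qed.

(** A lattice has vectors whose [i]-th and [j]-th coordinates have prescribed
    signs, and for some [r] the shear makes the [i]-th coordinate vanish. *)
Lemma shear_ray_escapes K x i j (ij : i != j) (s : R) :
  compact K -> A_invariant K -> K x -> s != 0 ->
  ~ (forall r, 0 < r -> K (translate (transvection ij (r * s)) x)).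
Proof.
move=> Kc KA Kx s0 ray; pose g := repr x.
pose E := n%:R * `|SL_mx g|.
have E0 : 0 <= E by rewrite mulr_ge0.
pose M := E / `|s| + E + 1.
pose y : 'cV[R]_n := \col_p (if p == i then - s * M else if p == j then M else 0).
(* [v] is an integral approximation of the preimage of [y]; [M] exceeds the
   error [E] by enough to preserve the signs. *)
pose v : 'cV[R]_n := \col_p (Num.floor ((SL_mx g^-1%g *m y) p ord0))%:~R.
have vZ : integral_vec v by move=> p; rewrite mxE; apply: intr_int.
have near p : `|(SL_mx g *m v) p ord0 - y p ord0| <= E.
  have -> : y = SL_mx g *m (SL_mx g^-1%g *m y).
    by rewrite mulmxA -SL_mxM mulgV mul1mx.
  set z := SL_mx g^-1%g *m y.
  have -> : (SL_mx g *m v) p ord0 - (SL_mx g *m z) p ord0 =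
      (SL_mx g *m (v - z)) p ord0 by rewrite mulmxBr !mxE.
  apply: le_trans (mx_entry_le _ _ _) _; apply: le_trans (mx_norm_mul _ _) _.
  rewrite /E ler_wpM2l// ler_piMr//; apply/mx_norm_leP => // q r.
  rewrite (ord1 r) !mxE -/z.
  have := floor_itv (z q ord0); rewrite mxE => /andP[z1 z2].
  by rewrite ler_norml; apply/andP; split; lra.
have := near i; have := near j; rewrite !mxE eqxx eq_sym (negPf ij) eqxx.
set a := \sum_q _; set b := \sum_q _ => ja ib.
have sn0 : 0 < `|s| by rewrite normr_gt0.
have a1 : 0 < a.
  move: ja; rewrite ler_distl /M => /andP[+ _]; apply: lt_le_trans.
  rewrite subr_gt0 -addrA addrC -addrA ltrDl ltr_pwDl//.
  by rewrite divr_ge0// ltW.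
have b1 : 0 < - b / s.
  have : `|- b / s - M| <= E / `|s|.
    rewrite (_ : - b / s - M = - (b - - s * M) / s); last by field.
    by rewrite normrM normrN normfV ler_pM2r ?invr_gt0.
  rewrite ler_distl /M => /andP[+ _]; apply: lt_le_trans.
  by move: (E / `|s|) => q; lra.
have r0 : 0 < - b / s / a by rewrite divr_gt0.
have := ray _ r0; rewrite -[x]coset_SLZ_repr translate_coset => Kr.
have v0 : v != 0.
  apply: contraTneq a1 => v0.
  have -> : a = (SL_mx g *m v) j ord0 by rewrite mxE.
  by rewrite v0 mulmx0 mxE ltxx.
have /eqP := lattice_entry_neq0 i Kc KA Kr vZ v0; apply.
rewrite SL_mxM -mulmxA transvection_mx mulmxDl mul1mx -scalemxAl.
rewrite !mxE -/g -/b.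
rewrite (bigD1 j)//= big1 => [|q qj]; last first.
  by rewrite !mxE (negPf qj) andbF mul0r.
rewrite !mxE !eqxx mul1r addr0 -/a.
by field; rewrite s0 gt_eqF.
Qed.

End LatticeVectors.

(** * From transverse returns to shears *)

Section Isolation.
Local Open Scope ring_scope.
Context {R : realType} {n : nat}.
Local Notation G := (SL R n).
Local Notation X := (SL_mod_SLZ R n).
Local Notation act := (@diagA_act R n).
Implicit Types (g h k : G) (x y : X) (K Y : set X).

Lemma limit_pair Y K h : compact Y -> closed K ->
  (forall e, 0 < e -> exists k x,
    [/\ `|SL_mx k - SL_mx h| < e, Y x & K (translate k x)]) ->
  exists2 x, Y x & K (translate h x).
Proof.
move=> Yc Kc H.
pose P (e : R) x := exists2 k, `|SL_mx k - SL_mx h| < e & K (translate k x).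
have [x Yx lim] : exists2 x, Y x & forall e, 0 < e -> exists e' k,
    [/\ 0 < e' <= e, near1 e k, Y (translate k x) & P e' (translate k x)].
  apply: compact_translate => // e /H [k [x [kh Yx Kx]]].
  by exists x => //; exists k.
exists x => //; apply: closed_translate => // e e0.
have [d d0 Hd] := SL_mul_near h 1%g e0.
have [e' [k [/andP[_ e'd] kn _ [l lh Kl]]]] := lim _ d0.
exists (l * k)%g; last by rewrite translateM.
by rewrite -[h]mulg1; apply: Hd => //; apply: lt_le_trans e'd.
Qed.

Lemma contract_interval_lt (u v a b : nat) : (b < a)%N -> (v - u <= a - b)%N ->
  ~ (a = v /\ b = u) ->
  ((if u <= b <= v then u else b) < (if u <= a <= v then u else a))%N.
Proof. by do 2 case: ifP; lia. Qed.

(** Conjugation by a one-parameter group that fixes the entry [(i, j)] of [h]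
    and contracts the other entries off the diagonal leads to a single shear.
    If the pair is chosen with [d i - d j] minimal, the weights may be [d] made
    constant on the interval from [d j] to [d i]: no other nonzero entry
    off the diagonal has both its indices there. *)
Lemma unipotent_to_shear K Y (d : 'I_n -> nat) h :
  injective d -> compact Y -> closed K -> A_invariant K -> A_invariant Y ->
  (forall p, SL_mx h p p = 1) ->
  (forall p q, (d p < d q)%N -> SL_mx h p q = 0) ->
  (exists p q, (d q < d p)%N /\ SL_mx h p q != 0) ->
  (exists2 z, Y z & K (translate h z)) ->
  exists i j (ij : i != j) t z,
    [/\ t != 0, Y z & K (translate (transvection ij t) z)].
Proof.
move=> dI Yc Kc KA YA h1 h0 [p0 [q0 hpq0]] [z Yz Kz].
pose S (pq : 'I_n * 'I_n) := (d pq.2 < d pq.1)%N && (SL_mx h pq.1 pq.2 != 0).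
have S0 : S (p0, q0) by apply/andP.
have [[i j] /andP[/= dji hij] dmin] :=
  arg_minnP (fun pq : 'I_n * 'I_n => d pq.1 - d pq.2)%N S0.
have ij : i != j by apply: contraTneq dji => ->; rewrite ltnn.
exists i, j, ij, (SL_mx h i j).
suff [x Yx Kx] : exists2 x, Y x & K (translate (transvection ij (SL_mx h i j)) x).
  by exists x.
apply: limit_pair => // e e0.
have [m me] := dyadic_small `|SL_mx h| e0.
pose f p := if (d j <= d p <= d i)%N then d j else d p.
have [a aE] := exists_dyadic_root (R := R) (fun p => - (m * f p)%:Z).
exists (diagA_val a * h * (diagA_val a)^-1)%g, (act a z); split; last first.
- rewrite -[act a z]/(translate (diagA_val a) z) -translateM mulgVK translateM.
  exact: KA.
- exact: YA.
apply/mx_norm_ltP => // p q; rewrite mxE [X in _ + X]mxE diag_conj_entry.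
rewrite transvection_mx !mxE aE.
have [->|pq] := eqVneq p q.
  rewrite subrr mulr0 expr0z mul1r h1; case: andP => [[/eqP qi /eqP qj]|_].
    by rewrite -qi -qj eqxx in ij.
  by rewrite mulr0 addr0 subrr normr0.
rewrite add0r; have [/andP[/eqP -> /eqP ->]|npq] := boolP ((p == i) && (q == j)).
  rewrite {1 2}/f !leqnn (ltnW dji) /= subrr mulr0 expr0z mul1r mulr1.
  by rewrite subrr normr0.
rewrite mulr0 subr0.
have [->|hpq] := eqVneq (SL_mx h p q) 0; first by rewrite mulr0 normr0.
have dqp : (d q < d p)%N.
  rewrite ltnNge leq_eqVlt; apply/negP => /orP[/eqP/dI/eqP|/h0/eqP].
    by rewrite (negPf pq).
  by rewrite (negPf hpq).
have fqp : (f q < f p)%N.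
  have /= := dmin (p, q); rewrite /S /= dqp hpq => /(_ isT) le_d.
  have ne : ~ (d p = d i /\ d q = d j).
    by move=> [/dI pi /dI qj]; rewrite pi qj !eqxx in npq.
  exact: contract_interval_lt.
rewrite normrM; apply: le_lt_trans me; rewrite mulrC ler_pM//.
  exact: mx_entry_le.
rewrite ger0_norm ?exprz_ge0// exprnN ler_weXz2l ?ler1n//.
have n0 : (0 < n)%N by apply: leq_ltn_trans (ltn_ord i).
have [r ->] : exists r : nat, f p = (f q + r.+1)%N by exists (f p - f q).-1%N; lia.
have : (m <= n * m * r.+1)%N by rewrite mulnAC leq_pmull// muln_gt0 n0.
move: (f q) => b; lia.
Qed.

Lemma eq0_small (x : R) : (forall e, 0 < e -> `|x| <= e + e) -> x = 0.
Proof.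
move=> H; apply/eqP; apply: contraT => x0.
have x1 : 0 < `|x| / 4 by rewrite divr_gt0 ?normr_gt0.
have := H _ x1; lra.
Qed.

(** Conjugation by a one-parameter group with weights [d] expands the entries
    [(p, q)] with [d q < d p] and contracts the opposite ones.  By the largest
    power of it that keeps the former at most [1], the elements [h] are brought
    to a compact set away from the diagonal matrices, and their limits are
    unipotent. *)
Lemma upper_to_shear K Y (d : 'I_n -> nat) :
  injective d -> (forall p, d p <= n)%N ->
  compact Y -> closed K -> A_invariant K -> A_invariant Y ->
  (forall e, 0 < e -> exists h p q z, [/\ near1 e h, (d q < d p)%N,
     SL_mx h p q != 0, Y z & K (translate h z)]) ->
  exists i j (ij : i != j) t z,
    [/\ t != 0, Y z & K (translate (transvection ij t) z)].
Proof.
move=> dI dn Yc Kc KA YA H.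
(* One further step of the one-parameter group multiplies no entry by more than
   [2 ^ (n * n)], so one of the expanded entries is at least [c]. *)
pose c : R := (2 ^+ (n * n))^-1.
have c0 : 0 < c by rewrite invr_gt0 exprn_gt0.
pose P e (M : 'M[R]_n) := exists k x, [/\ SL_mx k = M, Y x, K (translate k x) &
  [/\ forall p, `|M p p - 1| <= e, forall p q, (d p < d q)%N -> `|M p q| <= e &
  exists p q, (d q < d p)%N /\ c <= `|M p q|]].
have PH e : 0 < e -> exists M, `|M| <= 2 /\ P e M.
  move=> e0; have e1 : 0 < Num.min e 1 by rewrite lt_min e0 ltr01.
  have [h [p0 [q0 [z [hn dpq0 hpq0 Yz Kz]]]]] := H _ e1.
  have n0 : (0 < n)%N by apply: leq_ltn_trans (ltn_ord p0).
  have hb p q : p != q -> `|SL_mx h p q| <= Num.min e 1.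
    move=> pq; have /mx_norm_ltP -/(_ e1 p q) := hn.
    by rewrite !mxE (negPf pq) subr0 => /ltW.
  pose Q m := [forall p, forall q, (d q < d p)%N ==>
    (`|SL_mx h p q| * 2 ^+ (n * m * (d p - d q)) <= 1)].
  have exm : exists m, ~~ Q m.
    exists (Num.bound `|SL_mx h p0 q0|^-1); apply/negP => /forallP/(_ p0).
    move=> /forallP/(_ q0); rewrite dpq0 /= leNgt => /negP; apply.
    rewrite mulrC -ltr_pdivrMr ?normr_gt0// div1r upper_nthrootP//.
    by rewrite mulnAC leq_pmull// muln_gt0 n0 subn_gt0.
  have [[|m] Qm mmin] := ex_minnP exm.
    move: Qm => /negP[]; apply/forallP => p; apply/forallP => q.
    apply/implyP => dqp; rewrite muln0 mul0n expr0 mulr1.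
    apply: le_trans (hb _ _ _) _; last by rewrite ge_min lexx orbT.
    by apply: contraTneq dqp => ->; rewrite ltnn.
  have {mmin} Qm' : Q m.
    by apply: contraT => /mmin; rewrite ltnn.
  have [a aE] := exists_dyadic_root (R := R) (fun p => (m * d p)%:Z).
  have aE' p q : (d q < d p)%N -> troot p q a = 2 ^+ (n * m * (d p - d q)).
    move=> dqp; rewrite aE exprnP; congr (_ ^ _); nia.
  pose h' := (diagA_val a * h * (diagA_val a)^-1)%g.
  have small p q : (d p < d q)%N -> `|SL_mx h' p q| <= Num.min e 1.
    move=> dpq; rewrite diag_conj_entry normrM.
    rewrite -[leRHS]mul1r ler_pM//; last first.
      by apply: hb; apply: contraTneq dpq => ->; rewrite ltnn.
    rewrite gtr0_norm ?troot_gt0// -invf_ge1 ?troot_gt0//.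
    by rewrite /troot invf_div -/(troot q p a) aE'// exprn_ege1// ler1n.
  have diag p : `|SL_mx h' p p - 1| <= Num.min e 1.
    rewrite diag_conj_entry /troot divff ?gt_eqF ?dentry_gt0// mul1r.
    by have /mx_norm_ltP -/(_ e1 p p) := hn; rewrite !mxE eqxx => /ltW.
  exists (SL_mx h'); split.
    apply/mx_norm_leP => // p q.
    have [<-|pq] := eqVneq p q.
      rewrite -[SL_mx h' p p](subrK 1); apply: le_trans (ler_normD _ _) _.
      rewrite normr1 -[2]/(1 + 1) lerD2r; apply: le_trans (diag p) _.
      by rewrite ge_min lexx orbT.
    have [dpq|dqp|/dI/eqP] := ltngtP (d p) (d q).
    - apply: le_trans (small _ _ dpq) _; apply: (@le_trans _ _ 1).
        by rewrite ge_min lexx orbT.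
      by rewrite ler1n.
    - rewrite diag_conj_entry aE'// normrM ger0_norm ?exprn_ge0// mulrC.
      move: Qm' => /forallP/(_ p)/forallP/(_ q); rewrite dqp /= => Qm'.
      by apply: le_trans Qm' _; rewrite ler1n.
    - by rewrite (negPf pq).
  exists h', (act a z); split=> //.
  - exact: YA.
  - rewrite -[act a z]/(translate (diagA_val a) z) -translateM mulgVK translateM.
    exact: KA.
  split=> [p|p q dpq|].
  - by apply: le_trans (diag p) _; rewrite ge_min lexx.
  - by apply: le_trans (small _ _ dpq) _; rewrite ge_min lexx.
  move: Qm; rewrite negb_forall => /existsP[p]; rewrite negb_forall.
  move=> /existsP[q]; rewrite negb_imply -ltNge => /andP[dqp hpq].
  exists p, q; split=> //; rewrite diag_conj_entry aE'// normrM.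
  rewrite ger0_norm ?exprn_ge0// mulrC.
  have E : (n * m.+1 * (d p - d q) = n * m * (d p - d q) + n * (d p - d q))%N.
    by rewrite mulnS mulnDl addnC.
  move: hpq; rewrite E exprD mulrA; set y := _ * _ ^+ _ => y1.
  have y0 : 0 <= y by rewrite mulr_ge0 ?exprn_ge0.
  rewrite /c -div1r ler_pdivrMr ?exprn_gt0//; apply: le_trans (ltW y1) _.
  rewrite ler_wpM2l// ler_weXn2l ?ler1n//.
  have := dn p; nia.
have [A0 [_ lim]] := matrix_limit PH.
have A1 p : A0 p p = 1.
  apply/eqP; rewrite -subr_eq0; apply/eqP/eq0_small => e e0.
  have [e' [M [/andP[_ e'e] MA [k [x [_ _ _ [Md _ _]]]]]]] := lim _ e0.
  rewrite -[_ - 1](subrKA (M p p)); apply: le_trans (ler_normD _ _) _.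
  rewrite lerD//; last by apply: le_trans (Md p) _.
  have := mx_entry_le (M - A0) p p; rewrite !mxE distrC => /le_trans.
  by apply; exact: ltW.
have Alow p q : (d p < d q)%N -> A0 p q = 0.
  move=> dpq; apply/eq0_small => e e0.
  have [e' [M [/andP[_ e'e] MA [k [x [_ _ _ [_ Ml _]]]]]]] := lim _ e0.
  rewrite -[A0 p q](subrK (M p q)); apply: le_trans (ler_normD _ _) _.
  rewrite lerD//; last by apply: le_trans (Ml p q dpq) _.
  have := mx_entry_le (M - A0) p q; rewrite !mxE distrC => /le_trans.
  by apply; exact: ltW.
have Aup : exists p q, (d q < d p)%N /\ A0 p q != 0.
  have [e' [M [/andP[_ e'e] MA [k [x [_ _ _ [_ _ [p [q [dqp Mc]]]]]]]]]] := lim _ c0.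
  exists p, q; split=> //; apply: contraTneq Mc => A00; rewrite -ltNge.
  by have /mx_norm_ltP -/(_ c0 p q) := MA; rewrite !mxE A00 subr0.
have detA : \det A0 == 1.
  apply: contraT => A01; have e0 : 0 < `|\det A0 - 1| by rewrite normr_gt0 subr_eq0.
  have /nbhs_ballP[e /= e1 He] := @continuous_det R n A0 _ (nbhsx_ballx (\det A0) _ e0).
  have [e' [M [_ MA [k [x [kM _ _ _]]]]]] := lim _ e1.
  have := He M; rewrite -!ball_normE /= distrC => /(_ MA).
  by rewrite -kM SL_det ltxx.
pose h : G := MkSL detA.
apply: (@unipotent_to_shear K Y d h) => //.
apply: limit_pair => // e e0.
have [e' [M [_ MA [k [x [kM Yx Kx _]]]]]] := lim _ e0.
by exists k, x; rewrite kM.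
Qed.

(** Near the identity an element outside [A] has a nonzero entry off the
    diagonal.  Either entries below the diagonal occur arbitrarily close to the
    identity, or entries above it do; the two cases differ by the reversal of
    the order of the indices. *)
Lemma transverse_return_shear K Y :
  compact Y -> closed K -> A_invariant K -> A_invariant Y ->
  (forall e, 0 < e -> exists h z, [/\ near1 e h, h \notin @pos_diag R n,
     Y z & K (translate h z)]) ->
  exists i j (ij : i != j) t z,
    [/\ t != 0, Y z & K (translate (transvection ij t) z)].
Proof.
move=> Yc Kc KA YA H.
pose good (d : 'I_n -> nat) (e : R) := exists h p q z, [/\ near1 e h,
  (d q < d p)%N, SL_mx h p q != 0, Y z & K (translate h z)].
have [up|] := pselect (forall e, 0 < e -> good (@nat_of_ord n) e).
  by apply: (@upper_to_shear K Y (@nat_of_ord n)) => // [|p];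
    [exact: val_inj|exact: ltnW].
move=> /existsNP [e1 /not_implyP [e10 nup]].
apply: (@upper_to_shear K Y (fun p => n - p)%N) => //.
- move=> p q /= pq; apply: val_inj => /=.
  by have := ltn_ord p; have := ltn_ord q; lia.
- by move=> p; exact: leq_subr.
move=> e e0; pose f := Num.min e (Num.min e1 1).
have f0 : 0 < f by rewrite !lt_min e0 e10 ltr01.
have [h [z [hf hA Yz Kz]]] := H _ f0.
have [p [q [pq hpq]]] : exists p q, p != q /\ SL_mx h p q != 0.
  apply: contrapT => nex; move/negP: hA; apply; apply/pos_diagP; split.
    by move=> p q pq; apply/eqP; apply: contraT => hpq; exfalso; apply: nex; exists p, q.
  move=> p; have /mx_norm_ltP -/(_ f0 p p) := hf; rewrite !mxE eqxx.
  move=> /lt_le_trans -/(_ 1); rewrite /f !ge_min lexx !orbT => /(_ isT).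
  by rewrite ltr_distl subrr => /andP[].
exists h, p, q, z; split=> //.
  by apply: near1_le hf; rewrite /f ge_min lexx.
have := ltn_ord p; have := ltn_ord q.
have [qp|pq'|/val_inj pq'] := ltngtP q p.
- exfalso; apply: nup; exists h, p, q, z; split=> //.
  by apply: near1_le hf; rewrite /f !ge_min lexx orbT.
- by move=> _ _; rewrite ltn_sub2l.
- by rewrite pq' eqxx in pq.
Qed.

End Isolation.

(** * From one shear to a ray of shears *)

Section ShearReturns.
Local Open Scope ring_scope.
Context {R : realType} {n : nat}.
Local Notation G := (SL R n).
Local Notation X := (SL_mod_SLZ R n).
Local Notation act := (@diagA_act R n).
Implicit Types (g h k : G) (x y : X) (K Y : set X).

Lemma expr_unbounded (b x : R) : 1 < b -> exists m : nat, x < b ^+ m.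
Proof.
move=> b1; have b0 : 0 < b - 1 by rewrite subr_gt0.
have bern m : 1 + m%:R * (b - 1) <= b ^+ m.
  elim: m => [|m IH]; first by rewrite mul0r addr0 expr0.
  rewrite exprS -natr1; apply: le_trans (ler_wpM2l _ IH); last first.
    by rewrite ltW// (lt_trans _ b1).
  rewrite -subr_ge0 (_ : _ - _ = m%:R * (b - 1) ^+ 2); last by ring.
  by rewrite mulr_ge0// sqr_ge0.
exists (Num.bound `|x / (b - 1)|); apply: lt_le_trans (bern _).
rewrite -ltrBlDl -ltr_pdivrMr//.
have := archi_boundP (normr_ge0 (x / (b - 1))).
move=> /(le_lt_trans (ler_norm _)); apply: le_lt_trans.
by rewrite ler_pM2r ?invr_gt0// gerBl.
Qed.

Lemma expz_between (b x : R) : 1 < b -> 0 < x ->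
  exists k : int, b ^ k <= x < b ^ (k + 1).
Proof.
move=> b1 x0; have b0 : 0 < b by apply: lt_trans b1.
have [m xm] := expr_unbounded x b1.
have [l xl] := expr_unbounded x^-1 b1.
have ex : exists j : nat, x < b ^ (j%:Z - l%:Z).
  by exists (m + l)%N; rewrite PoszD addrK.
have [[|j] xj jmin] := ex_minnP ex.
  move: xj; rewrite sub0r -exprnN -[X in X < _]invrK.
  rewrite ltf_pV2 ?posrE ?invr_gt0 ?exprn_gt0//.
  by move=> /lt_trans/(_ xl); rewrite ltxx.
exists (j%:Z - l%:Z); apply/andP; split.
  by rewrite leNgt; apply/negP => /jmin; rewrite ltnn.
by rewrite (_ : _ + 1 = j.+1%:Z - l%:Z)//; lia.
Qed.

(** The conjugates by [A] of a geometric sequence of shears are geometric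
    sequences of the same ratio.  As the orbit of [z] is dense in [Y], every
    point of [Y] can be sheared forward within [Y] by an amount of any
    prescribed order of magnitude, and a supremum argument yields a whole ray. *)
Lemma geometric_shears_escape Y z i j (ij : i != j) (b s : R) :
  compact_A_minimal Y -> Y z -> 1 < b -> s != 0 ->
  ~ (forall k : int, Y (translate (transvection ij (b ^ k * s)) z)).
Proof.
move=> [Yc [_ Ycl YA Ymin]] Yz b1 s0 H.
have YI : A_invariant Y by move=> a x; exact: YA.
have b0 : 0 < b by apply: lt_trans b1.
have step x d : Y x -> 0 < d ->
    exists2 t, d <= t <= d * b & Y (translate (transvection ij (t * s)) x).
  move=> Yx d0.
  pose P (e : R) t := exists2 h, near1 e h &
    Y (translate (transvection ij (t * s) * h)%g x).
  have [|t [dt lim]] :=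
      compact_limit (P := P) (@segment_compact R d (d * b)).
    move=> e e0; have /closure_translateP /(_ e e0) [h hn [a _ ha]] := Ymin z Yz x Yx.
    have ra0 := troot_gt0 i j a.
    have [k /andP[k1 k2]] := expz_between b1 (divr_gt0 d0 ra0).
    rewrite ler_pdivlMr// in k1; rewrite ltr_pdivrMr// expfzDr ?gt_eqF// expr1z in k2.
    exists (b ^ (k + 1) * troot i j a); split.
      rewrite /= in_itv/= expfzDr ?gt_eqF// expr1z (ltW k2)/=.
      by rewrite mulrAC ler_pM2r.
    exists h => //; rewrite translateM -ha.
    rewrite -[act a z]/(translate (diagA_val a) z) -translateM.
    rewrite (_ : _ * _ = diagA_val a * transvection ij (b ^ (k + 1) * s))%g.
      by rewrite translateM; exact: YI.
    have -> : b ^ (k + 1) * troot i j a * s = troot i j a * (b ^ (k + 1) * s).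
      by ring.
    by rewrite -transvection_conj mulgVK.
  exists t; first by move: dt; rewrite /= in_itv.
  apply: closed_translate => // e e0.
  have [c c0 Hc] := SL_mul_near (transvection ij (t * s)) 1%g e0.
  have U0 : nbhs t (ball t (c / `|s|)).
    by apply: nbhsx_ballx; rewrite divr_gt0 ?normr_gt0.
  have [e' [t' [/andP[_ e'c] tt' _ [h hn Yh]]]] := lim _ _ U0 c0.
  exists (transvection ij (t' * s) * h)%g => //.
  rewrite -[transvection ij (t * s)]mulg1; apply: Hc; last first.
    exact: lt_le_trans e'c.
  apply: le_lt_trans (transvection_near _ _ _) _.
  rewrite -mulrBl normrM -ltr_pdivlMr ?normr_gt0//.
  by move: tt'; rewrite -ball_normE /= distrC.
apply: (@shear_ray_escapes _ _ Y z i j ij s) => // r r0.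
pose T := [set t : R | 0 <= t <= r /\ Y (translate (transvection ij (t * s)) z)].
have T0 : T 0 by split; rewrite ?lexx ?ltW// mul0r transvection0 translate1.
have Tub : ubound T r by move=> t [/andP[]].
have Tsup : has_sup T by split; [exists 0|exists r].
pose t := sup T.
have t0 : 0 <= t by apply: sup_upper_bound.
have tr : t <= r by apply: ge_sup => //; exists 0.
have Yt : Y (translate (transvection ij (t * s)) z).
  apply: closed_translate => // e e0.
  have es0 : 0 < e / `|s| by rewrite divr_gt0 ?normr_gt0.
  have [u Tu ut] := sup_adherent es0 Tsup.
  have ut' : u <= t by apply: sup_upper_bound.
  exists (transvection ij (u * s)); last by case: Tu.
  apply: le_lt_trans (transvection_near _ _ _) _.
  rewrite -mulrBl normrM -ltr_pdivlMr ?normr_gt0// distrC [`|t - u|]ger0_norm ?subr_ge0//.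
  by move: ut; rewrite -/t; lra.
have [->//|tr'] := eqVneq r t.
have {}tr' : t < r by rewrite lt_neqAle eq_sym tr'.
have d0 : 0 < (r - t) / b by rewrite divr_gt0// subr_gt0.
have [u /andP[du ub] Yu] := step _ _ Yt d0.
have : T (u + t).
  split; last by rewrite mulrDl transvectionD translateM.
  rewrite addr_ge0 ?(ltW (lt_le_trans d0 du))//=.
  by move: ub; rewrite mulfVK ?gt_eqF// lerBrDr.
move=> /(sup_upper_bound Tsup); rewrite -/t gerDr leNgt.
by rewrite (lt_le_trans d0 du).
Qed.

(** Contracting the root space refines the arithmetic progression of shears
    to all of a ray, at a limit point. *)
Lemma arithmetic_shears_escape Y z i j (ij : i != j) (s : R) :
  compact Y -> closed Y -> A_invariant Y -> Y z -> s != 0 ->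
  ~ (forall k : nat, Y (translate (transvection ij (k%:R * s)) z)).
Proof.
move=> Yc Ycl YI Yz s0 H.
pose P (e : R) x := exists2 c, 0 < c < e &
  forall k : nat, Y (translate (transvection ij (k%:R * (c * s))) x).
have [x Yx lim] : exists2 x, Y x & forall e, 0 < e -> exists e' k,
    [/\ 0 < e' <= e, near1 e k, Y (translate k x) & P e' (translate k x)].
  apply: compact_translate => // e e0.
  have [m me] := dyadic_small 1 e0.
  have [a aE] := exists_dyadic_root (R := R) (fun p => - (m * (p == i))%:Z).
  exists (act a z); first exact: YI.
  exists (troot i j a).
    rewrite troot_gt0 /=; apply: le_lt_trans me; rewrite mul1r aE exprnN.
    rewrite eqxx eq_sym (negPf ij) ler_weXz2l ?ler1n//.
    have := ltn_ord i; nia.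
  move=> k.
  have -> : k%:R * (troot i j a * s) = troot i j a * (k%:R * s) by ring.
  rewrite -transvection_conj -[act a z]/(translate (diagA_val a) z) -translateM.
  by rewrite mulgVK translateM; exact: YI.
apply: (@shear_ray_escapes _ _ Y x i j ij s) => // r r0.
apply: closed_translate => // e e0.
have [c c0 Hc] := SL_mul_near (transvection ij (r * s)) 1%g e0.
have sn0 : 0 < `|s| by rewrite normr_gt0.
have cs : 0 < Num.min c (c / `|s|) by rewrite lt_min c0 divr_gt0.
have [e' [h [/andP[_ e'c] hn _ [d /andP[d0 de] Yd]]]] := lim _ cs.
pose k := Num.truncn (r / d).
exists (transvection ij (k%:R * (d * s)) * h)%g; last by rewrite translateM.
rewrite -[transvection ij (r * s)]mulg1; apply: Hc; last first.
  by apply: lt_le_trans hn _; rewrite ge_min lexx.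
apply: le_lt_trans (transvection_near _ _ _) _.
rewrite mulrA -mulrBl normrM -ltr_pdivlMr//.
have /andP[k1 k2] := truncn_itv (divr_ge0 (ltW r0) (ltW d0)).
rewrite -/k ler_pdivlMr// in k1; rewrite -/k ltr_pdivrMr// -natr1 in k2.
have dc : d < c / `|s|.
  by apply: lt_le_trans de _; apply: le_trans e'c _; rewrite ge_min lexx orbT.
rewrite ler0_norm ?subr_le0//; lra.
Qed.

(** If [z] and its shear both lie in [Y], both can be moved to [Y0] by [A]; this
    gives an element [h = c^-1 u(t1)] of the group generated by [A] and the
    shears such that [h] and its inverse map [Y0] into [Y0].  If the root is
    trivial on [c], the powers of [h] give an arithmetic progression of shears.
    Otherwise [h] is the conjugate of [c^-1] by the shear of parameter [u], and
    the powers of [h] give a geometric progression of shears of the points of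
    the translate of [Y0] by that shear. *)
Lemma no_shear_return Y (Y0 : set X) i j (ij : i != j) :
  compact_A_minimal Y -> Y0 `<=` Y ->
  (forall y, Y y -> exists a z, Y0 z /\ y = act a z) ->
  (forall a t z z', Y0 z -> Y0 z' ->
    Y0 (translate (diagA_val a * transvection ij t)%g z) ->
    Y0 (translate (diagA_val a * transvection ij t)%g z')) ->
  forall z t, t != 0 -> Y z -> ~ Y (translate (transvection ij t) z).
Proof.
move=> Ymin Y0Y AY0 Y0h z t t0 Yz Ytz.
have [Yc [_ Ycl YA _]] := Ymin.
have YI : A_invariant Y by move=> a x; exact: YA.
have [a [z0 [Y0z0 zE]]] := AY0 _ Yz.
pose t1 := troot i j a^-1%g * t.
have t1_neq0 : t1 != 0 by rewrite mulf_neq0// gt_eqF ?troot_gt0.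
have Yt1 : Y (translate (transvection ij t1) z0).
  rewrite /t1 -transvection_conj !translateM.
  apply: (YI a^-1%g).
  rewrite (_ : (diagA_val a^-1)^-1 = diagA_val a)%g; last exact: invgK.
  by rewrite -[translate _ z0]zE.
have [c [z1 [Y0z1 z1E]]] := AY0 _ Yt1.
pose b := troot i j c; have b0 : 0 < b by exact: troot_gt0.
have h0 : translate (diagA_val c^-1%g * transvection ij t1)%g z0 = z1.
  by rewrite translateM z1E; exact: translateK.
have h1 : translate (diagA_val c * transvection ij (- (b^-1 * t1)))%g z1 = z0.
  rewrite -h0 -translateM.
  rewrite (_ : _ * _ = 1)%g ?translate1//.
  rewrite transvectionN /b -trootV -transvection_conj.
  rewrite (_ : diagA_val c^-1%g = (diagA_val c)^-1)%g//.
  by rewrite !invgM invgK mulgA !mulgA mulgV mul1g mulgVK mulVg.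
(* Right multiplication by [h] makes [S] stable under [s |-> b * s + t1]. *)
pose S s := forall x, Y0 x -> Y (translate (transvection ij s) x).
have S0 : S 0 by move=> x /Y0Y; rewrite transvection0 translate1.
have Sfwd s : S s -> S (b * s + t1).
  move=> Ss x Y0x; have := Ss _ (Y0h _ _ _ x Y0z0 Y0x (eq_ind_r Y0 Y0z1 h0)).
  move=> /(YI c); rewrite -[act c _]/(translate (diagA_val c) _) -!translateM.
  rewrite transvectionD /b -transvection_conj.
  by rewrite (_ : diagA_val c^-1%g = (diagA_val c)^-1)%g// !mulgA.
have Sbwd s : S s -> S (b^-1 * (s - t1)).
  move=> Ss x Y0x; have := Ss _ (Y0h _ _ _ x Y0z1 Y0x (eq_ind_r Y0 Y0z0 h1)).
  move=> /(YI c^-1%g); rewrite -[act _ _]/(translate (diagA_val _) _) -!translateM.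
  rewrite mulrBr transvectionD /b -trootV -transvection_conj.
  rewrite (_ : diagA_val c^-1%g = (diagA_val c)^-1)%g// invgK.
  by rewrite !mulgA.
have [b1|b1] := eqVneq b 1.
  apply: (@arithmetic_shears_escape Y z0 i j ij t1) => // [|k]; first exact: Y0Y.
  suff : S (k%:R * t1) by exact.
  elim: k => [|k IH]; first by rewrite mul0r.
  by rewrite -natr1 mulrDl mul1r -{1}[_ * t1]mul1r -{1}b1; exact: Sfwd.
have b1' : 1 - b != 0 by rewrite subr_eq0 eq_sym.
(* [u] is the fixed point of that affine map. *)
pose u := t1 / (1 - b).
have u0 : u != 0 by rewrite mulf_neq0// invr_eq0.
have t1E : t1 = u * (1 - b) by rewrite mulfVK.
have Sk (k : int) : S (u * (1 - b ^ k)).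
  have nat_case (m : nat) : S (u * (1 - b ^+ m)) /\ S (u * (1 - b ^- m)).
    elim: m => [|m [IH1 IH2]]; first by rewrite expr0 invr1 subrr mulr0.
    split.
      have -> : u * (1 - b ^+ m.+1) = b * (u * (1 - b ^+ m)) + t1.
        by rewrite t1E exprS; ring.
      exact: Sfwd.
    have -> : u * (1 - b ^- m.+1) = b^-1 * (u * (1 - b ^- m) - t1).
      rewrite t1E exprS; field.
      by have bn : b != 0 by [rewrite gt_eqF]; rewrite ?bn ?expf_neq0.
    exact: Sbwd.
  case: k => m; first by have [] := nat_case m.
  by have [] := nat_case m.+1.
pose B := if 1 < b then b else b^-1.
have B1 : 1 < B.
  rewrite /B; case: ifPn => //; rewrite -leNgt => ble1.
  by rewrite -invf_lt1 ?invrK ?invr_gt0// lt_neqAle b1.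
have B0 : 0 < B by apply: lt_trans B1.
have SB (k : int) : S (u * (1 - B ^ k)).
  rewrite /B; case: ifP => _ //.
  by rewrite exprz_inv; exact: Sk.
have Su : S u.
  move=> x Y0x; apply: closed_translate => // e e0.
  have [m me] := expr_unbounded (`|u| / e) B1.
  exists (transvection ij (u * (1 - B ^ (- m%:Z)))); last exact: SB.
  apply: le_lt_trans (transvection_near _ _ _) _.
  have -> : u * (1 - B ^ (- m%:Z)) - u = - (u * B ^- m) by rewrite -exprnN; ring.
  rewrite normrN normrM normfV [`|B ^+ m|]gtr0_norm ?exprn_gt0//.
  by rewrite ltr_pdivrMr ?exprn_gt0// mulrC -ltr_pdivrMr.
apply: (@geometric_shears_escape Y (translate (transvection ij u) z0) i j ij B
  (- u)) => //; [exact: Su|by rewrite oppr_eq0|move=> k].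
have := SB k _ Y0z0; rewrite -translateM -transvectionD.
by rewrite (_ : B ^ k * - u + u = u * (1 - B ^ k))//; ring.
Qed.

End ShearReturns.

(** * Minimal sets and orbits *)

Section MinimalSets.
Local Open Scope ring_scope.
Context {R : realType} {n : nat}.
Local Notation G := (SL R n).
Local Notation X := (SL_mod_SLZ R n).
Local Notation act := (@diagA_act R n).
Implicit Types (g h k : G) (x y : X) (K Y : set X) (B : set (diagA R n)).

Lemma closure_stable (S : set X) g :
  (forall x, S x -> S (translate g x)) ->
  forall x, closure S x -> closure S (translate g x).
Proof.
move=> Sg x /closure_translateP Sx; apply/closure_translateP => e e0.
have [d d0 dg] := near1_conj g e0.
have [h hd Sh] := Sx _ d0; exists (g * h * g^-1)%g; first exact: dg.
by rewrite -translateM mulgVK translateM; exact: Sg.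
Qed.

(** Zorn's lemma is applied to the open complements of the invariant sets that
    meet [K]. *)
Lemma exists_minimal_set B K : B 1%g ->
  (forall a b, B a -> B b -> B (a * b)%g) -> compact K -> closed K ->
  K !=set0 -> (forall a x, B a -> K x -> K (act a x)) ->
  exists2 Y, Y `<=` K & minimal_set act B Y.
Proof.
move=> B1 BM Kc Kcl K0 KB.
pose P (C : set X) := [/\ open C,
  (forall a x, B a -> ~ C x -> ~ C (act a x)) & K `&` ~` C !=set0].
have [|C [[Co CB [y0 [Ky0 Cy0]]] Cmax]] := @Zorn_bigcup X P.
  move=> F FP Ftot; split.
  - by apply: bigcup_open => C /FP[].
  - move=> a x Ba Cx [C FC Cax].
    by have [_ CB _] := FP _ FC; apply: (CB a x Ba) Cax => ?; apply: Cx; exists C.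
  pose D (C : set X) := K `&` ~` C.
  have [F0|F0] := pselect (F !=set0); last first.
    have [x Kx] := K0; exists x; split=> // -[C FC _]; apply: F0; by exists C.
  have FF : ProperFilter (filter_from F D).
    apply: filter_from_proper; last by move=> C /FP[].
    apply: filter_from_filter => // C C' FC FC'.
    have [CC'|C'C] := Ftot _ _ FC FC'.
      by exists C' => // x [Kx Cx]; split; split=> // /CC'.
    by exists C => // x [Kx Cx]; split; split=> // /C'C.
  have FK : filter_from F D K.
    by have [C FC] := F0; exists C => // x [].
  have [x [Kx cl]] := Kc _ FF FK.
  exists x; split=> // -[C FC Cx].
  have Dn : filter_from F D (D C) by exists C.
  have [Co _ _] := FP _ FC.
  have Cn : nbhs x C by apply: open_nbhs_nbhs.
  by have [y [[_ Cy] /Cy]] := cl _ _ Dn Cn.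
exists (K `&` ~` C); first by move=> x [].
split.
- by exists y0.
- by apply: closedI => //; exact: open_closedC.
- by move=> a x Ba [Kx Cx]; split; [exact: KB|exact: CB].
move=> y [Ky Cy] x [Kx Cx]; apply: contrapT => nx.
have /existsNP[] : ~ (C `<` C `|` ~` closure (orbit_of act B y) ->
    ~ P (C `|` ~` closure (orbit_of act B y))).
  move=> /(_ _ _); apply.
    by split; [move=> z; left|move=> /(_ x) Cx'; apply/Cx/Cx'; right].
  split.
  - apply: openU => //; apply: closed_openC; exact: closed_closure.
  - move=> a z Ba /not_orP [Cz /contrapT zcl] [|]; first exact: CB.
    apply; apply: (@closure_stable _ (diagA_val a)) zcl => _ [b Bb <-].
    by exists (a * b)%g; [exact: BM|rewrite diagA_actM].
  exists y; split=> // -[//|]; apply; apply: subset_closure.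
  by exists 1%g => //; exact: diagA_act1.
by move=> C' ; apply; exact: Cmax.
Qed.

Lemma orbit_self (x : X) : orbit_of act setT x x.
Proof. by exists 1%g => //; exact: diagA_act1. Qed.

Lemma orbit_eq x y : orbit_of act setT x y -> orbit_of act setT x = orbit_of act setT y.
Proof.
move=> [a _ <-]; apply/seteqP; split=> _ [b _ <-].
  exists (b * a^-1)%g => //; rewrite diagA_actM; congr act.
  by rewrite -diagA_actM mulVg diagA_act1.
by exists (b * a)%g => //; rewrite diagA_actM.
Qed.

End MinimalSets.

(** * Compact orbits *)

Section Orbits.
Local Open Scope ring_scope.
Context {R : realType} {n : nat}.
Local Notation G := (SL R n).
Local Notation X := (SL_mod_SLZ R n).
Local Notation act := (@diagA_act R n).
Implicit Types (g h k : G) (x y : X) (K Y : set X) (a b s : diagA R n).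

(** Otherwise a shear would move a point of [Y] within [Y]; [no_shear_return]
    excludes it, with [Y0 = {y}]. *)
Lemma compact_orbit_isolated Y y : compact_A_minimal Y ->
  Y = orbit_of act setT y ->
  exists2 e : R, 0 < e & forall h z, near1 e h -> Y z -> Y (translate h z) ->
    h \in @pos_diag R n.
Proof.
move=> Ymin YE; apply: contrapT => noe.
have [Yc [_ Ycl YA _]] := Ymin.
have YI : A_invariant Y by move=> a x; exact: YA.
have [e e0|i [j [ij [t [z [t0 Yz Yt]]]]]] :=
    @transverse_return_shear R n Y Y Yc Ycl YI YI.
  apply: contrapT => nh; apply: noe; exists e => // h z hn Yz Yh.
  by apply: contrapT => /negP hA; apply: nh; exists h, z.
apply: (@no_shear_return R n Y [set y] i j ij) Yt => //.
- by move=> _ ->; rewrite YE; exact: orbit_self.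
- by move=> x; rewrite YE => -[a _ <-]; exists a, y.
- by move=> a u z1 z2 -> ->.
Qed.

Lemma char_poly_uconj (m : nat) (V f : 'M[R]_m) : V \in unitmx ->
  char_poly (V *m f *m invmx V) = char_poly f.
Proof.
move=> Vu; rewrite /char_poly /char_poly_mx.
have -> : 'X%:M - map_mx polyC (V *m f *m invmx V) = map_mx polyC V *m
    ('X%:M - map_mx polyC f) *m map_mx polyC (invmx V).
  rewrite mulmxBr mulmxBl !map_mxM; congr (_ - _).
  by rewrite scalar_mxC -mulmxA -map_mxM mulmxV// map_mx1 mulmx1.
by rewrite !det_mulmx mulrAC -det_mulmx -map_mxM mulmxV// map_mx1 det1 mul1r.
Qed.

(** If an integral matrix has a multiple eigenvalue and a simple one, then the
    derivative of its characteristic polynomial maps the integral vectors,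
    not all to zero, to vectors with no component along the multiple one. *)
Lemma integral_mixed_multiplicity m (c V : 'M[R]_m) (d : 'rV[R]_m) (i j k : 'I_m) :
  (forall p q, c p q \is a Num.int) -> V \in unitmx ->
  V *m c *m invmx V = diag_mx d -> i != j -> d ord0 i = d ord0 j ->
  (forall p, p != k -> d ord0 p != d ord0 k) ->
  exists w : 'cV[R]_m, [/\ integral_vec w, w != 0 & (V *m w) i ord0 = 0].
Proof.
case: m c V d i j k => [|m] c V d i j k; first by case: i.
move=> cZ Vu VcV ij dij dk.
pose c' : 'M[int]_m.+1 := \matrix_(p, q) Num.floor (c p q).
have cE : c = map_mx intr c'.
  by apply/matrixP => p q; rewrite !mxE; apply/esym/eqP; rewrite -intrEfloor.
pose q := (char_poly c)^`().
have qE : q = map_poly intr (char_poly c')^`().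
  by rewrite /q cE -map_char_poly deriv_map.
pose M := horner_mx c q.
have ME : M = map_mx intr (horner_mx c' (char_poly c')^`()).
  by rewrite /M qE cE map_horner_mx.
have VM : V *m M = diag_mx (map_mx (horner q) d) *m V.
  by rewrite -horner_mx_diag -VcV horner_mx_uconj// mulmxKV.
have chi : char_poly c = \prod_p ('X - (d ord0 p)%:P).
  rewrite -(char_poly_uconj c Vu) VcV char_poly_trig; last first.
    exact/diag_mx_is_trig.
  by apply: eq_bigr => p _; rewrite mxE eqxx mulr1n.
have qi : q.[d ord0 i] = 0.
  rewrite /q chi (bigD1 i)//= (bigD1 j) 1?eq_sym//= dij mulrA.
  set r := \prod_(p < _ | _) _.
  rewrite !derivM !derivXsubC mul1r mulr1.
  by rewrite !(hornerXsubC, hornerD, hornerM) subrr; ring.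
have qk : q.[d ord0 k] != 0.
  rewrite /q chi (bigD1 k)//= derivM derivXsubC !hornerE subrr mul0r addr0.
  rewrite horner_prod prodf_seq_neq0; apply/allP => p _; apply/implyP => pk.
  by rewrite !hornerE subr_eq0 eq_sym dk.
have [l Ml] : exists l, col l M != 0.
  apply: contrapT => Ml; have M0 : M = 0.
    apply/matrixP => a b; have [/colP/(_ a)|colb] := eqVneq (col b M) 0.
      by rewrite !mxE.
    by exfalso; apply: Ml; exists b.
  move: VM; rewrite M0 mulmx0 => /esym/(congr1 (mulmx^~ (invmx V))).
  rewrite -mulmxA mulmxV// mulmx1 mul0mx => /matrixP/(_ k k)/eqP.
  by rewrite !mxE eqxx mulr1n (negPf qk).
exists (col l M); split=> //.
  by move=> p; rewrite mxE ME mxE; exact: intr_int.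
have -> : (V *m col l M) i ord0 = (V *m M) i l.
  by rewrite !mxE; apply: eq_bigr => p _; rewrite mxE.
by rewrite VM mul_diag_mx !mxE qi mul0r.
Qed.

Lemma stabilizer_no_mixed_multiplicity K y s (i j k : 'I_n) :
  compact K -> A_invariant K -> K y -> act s y = y ->
  i != j -> dentry s i = dentry s j ->
  ~ (forall p, p != k -> dentry s p != dentry s k).
Proof.
move=> Kc KI Ky sy ij sij sk; pose g := repr y.
have : coset_SLZ g = coset_SLZ (diagA_val s * g)%g.
  by rewrite -diagA_act_coset coset_SLZ_repr sy.
move=> /coset_SLZP; set c := (_ * _)%g => /SLZP cZ.
have Ky' : K (coset_SLZ g) by rewrite coset_SLZ_repr.
have VcV : SL_mx g *m SL_mx c *m invmx (SL_mx g) = diag_mx (\row_p dentry s p).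
  by rewrite -diagA_mx -SL_mxV -!SL_mxM /c mulVKg mulgK.
have [|p pk|w [wZ w0 gw]] :=
    integral_mixed_multiplicity (k := k) cZ (SL_unitmx g) VcV ij.
- by rewrite !mxE.
- by rewrite !mxE sk.
by have /eqP := lattice_entry_neq0 i Kc KI Ky' wZ w0.
Qed.

End Orbits.

(** * Root values on the stabilizer of a compact orbit *)

Lemma ltn_addS (p q : nat) : (p < q)%N -> exists r : nat, q = (p + r.+1)%N.
Proof.
by move=> pq; exists (q - p).-1; rewrite prednK ?subn_gt0// subnKC// ltnW.
Qed.

Section StabilizerRoots.
Local Open Scope ring_scope.
Context {R : realType} {n : nat}.
Local Notation G := (SL R n).
Local Notation X := (SL_mod_SLZ R n).
Local Notation act := (@diagA_act R n).
Implicit Types (g h : G) (x y : X) (K Y : set X) (a b s : diagA R n).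

Lemma near1_dentry e a p : near1 e (diagA_val a) -> `|dentry a p - 1| < e.
Proof.
move=> ha; have e0 : 0 < e by apply: le_lt_trans ha.
by have /mx_norm_ltP -/(_ e0 p p) := ha; rewrite !mxE eqxx.
Qed.

(** There are infinitely many elements of [A] with equal [i]-th and [j]-th
    entries and the others far apart, so two of them move [y] to points that
    differ by an element near the identity, which lies in [A].  Their quotient,
    corrected by this element, fixes [y] and has close [i]-th and [j]-th
    entries.  These differ, because there is a further entry, which is
    simple. *)
Lemma stabilizer_root_near1 Y y (i j : 'I_n) (eta : R) : (3 <= n)%N ->
  compact_A_minimal Y -> Y = orbit_of act setT y -> i != j -> 0 < eta ->
  exists s, [/\ act s y = y, troot i j s != 1 & `|troot i j s - 1| < eta].
Proof.
move=> n3 Ymin YE ij eta0; have [Yc [_ Ycl YA _]] := Ymin.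
have YI : A_invariant Y by move=> a x; exact: YA.
have Yy : Y y by rewrite YE; exact: orbit_self.
have [e0 e00 iso] := compact_orbit_isolated Ymin YE.
(* These weights are distinct except at [i] and [j]. *)
pose w (p : 'I_n) : nat := if p == i then j else p.
have wij : w i = w j by rewrite /w eqxx eq_sym (negPf ij).
pose dy (m : nat) a := forall p q,
  troot p q a = 2 ^ (n%:Z * ((m * w p)%N%:Z - (m * w q)%N%:Z)).
pose P (e : R) x := exists m a, [/\ e^-1 <= m%:R, dy m a & x = act a y].
have [x Yx lim] : exists2 x, Y x & forall e, 0 < e -> exists e' h,
    [/\ 0 < e' <= e, near1 e h, Y (translate h x) & P e' (translate h x)].
  apply: compact_translate => // e _.
  have [a aE] := exists_dyadic_root (R := R)
    (fun p => (Num.bound `|e^-1| * w p)%N%:Z).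
  exists (act a y); first exact: YI.
  exists (Num.bound `|e^-1|), a; split=> //.
  apply: ltW; apply: le_lt_trans (ler_norm _) _.
  exact: archi_boundP.
pose e := Num.min e0 (Num.min 4^-1 (eta / 4)).
have ep : 0 < e by rewrite !lt_min e00 invr_gt0 divr_gt0 ?ltr0n.
have [d1 d10 dM] := near1M (n := n) ep.
have [d2 d20 dV] := near1V (n := n) d10.
have d0 : 0 < Num.min d1 d2 by rewrite lt_min d10.
have [e1 [h1 [_ hn1 Yh1 [m1 [a1 [_ dy1 xE1]]]]]] := lim _ d0.
have d0' : 0 < Num.min (Num.min d1 d2) m1.+1%:R^-1.
  by rewrite lt_min d0 invr_gt0 ltr0n.
have [e2 [h2 [/andP[e20 e2d] hn2 Yh2 [m2 [a2 [em2 dy2 xE2]]]]]] := lim _ d0'.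
have m12 : (m1 < m2)%N.
  rewrite -(ler_nat R); apply: le_trans em2; rewrite -[leLHS]invrK lef_pV2.
  - by apply: le_trans e2d _; rewrite ge_min lexx orbT.
  - by rewrite posrE invr_gt0 ltr0n.
  - by rewrite posrE.
pose h := (h2 * h1^-1)%g.
have hn : near1 e h.
  apply: dM; first by apply: near1_le hn2; rewrite !ge_min lexx.
  by apply: dV; apply: near1_le hn1; rewrite ge_min lexx orbT.
have hE : translate h (act a1 y) = act a2 y.
  by rewrite -xE1 -xE2 -translateM /h mulgVK.
have hA : h \in @pos_diag R n.
  apply: iso (act a1 y) _ _ _; first by apply: near1_le hn; rewrite ge_min lexx.
    exact: YI.
  by rewrite hE; exact: YI.
pose b : diagA R n := MkDiagA hA.
have b1 p : `|dentry b p - 1| < e by exact: near1_dentry.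
have e4 : e <= 4^-1 by rewrite !ge_min lexx !orbT.
have eeta : e <= eta / 4 by rewrite !ge_min lexx !orbT.
pose s := (a1^-1 * (b^-1 * a2))%g.
have sE p q : troot p q s = dentry b q / dentry b p *
    2 ^ (n%:Z * ((m2 - m1)%N%:Z * ((w p)%:Z - (w q)%:Z))).
  have -> : n%:Z * ((m2 - m1)%N%:Z * ((w p)%:Z - (w q)%:Z)) =
      n%:Z * ((m2 * w p)%N%:Z - (m2 * w q)%N%:Z) -
      n%:Z * ((m1 * w p)%N%:Z - (m1 * w q)%N%:Z).
    by rewrite -subzn 1?ltnW// !PoszM; ring.
  rewrite expfzDr// -invr_expz -dy1 -dy2 !trootM !trootV /troot !invf_div.
  by ring.
have sep p q : (w q < w p)%N -> dentry s p != dentry s q.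
  move=> wqp; apply/eqP => spq.
  have s1 : troot p q s = 1 by rewrite /troot spq divff ?gt_eqF ?dentry_gt0.
  have two : 2 <= (2 : R) ^ (n%:Z * ((m2 - m1)%N%:Z * ((w p)%:Z - (w q)%:Z))).
    rewrite -[leLHS]expr1z ler_weXz2l ?ler1n//.
    have [c ->] := ltn_addS m12; have [f ->] := ltn_addS wqp.
    rewrite addKn PoszD [_%:Z + _]addrC addrK -!PoszM lez_nat.
    by rewrite !muln_gt0 (leq_trans _ n3).
  move: s1; rewrite sE; move: two; set z := _ ^ _ => two.
  have := b1 p; have := b1 q; have := dentry_gt0 b p.
  move: (dentry b p) (dentry b q) => bp bq bp0.
  rewrite !ltr_distl => /andP[q1 q2] /andP[p1 p2] /(congr1 ( *%R^~ bp)).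
  rewrite mulrAC mulfVK ?gt_eqF// mul1r => E.
  have : bq * 2 <= bq * z by rewrite ler_wpM2l//; lra.
  by rewrite E; lra.
have sy : act s y = y.
  rewrite /s !diagA_actM -hE -[translate h _]/(act b _).
  rewrite -(diagA_actM b^-1%g) mulVg diagA_act1.
  by rewrite -diagA_actM mulVg diagA_act1.
have [k [ki kj]] : exists k : 'I_n, k != i /\ k != j.
  apply: contrapT => nk.
  have : (#|[set: 'I_n]%SET| <= #|[set i; j]%SET|)%N.
    apply: subset_leq_card; apply/fintype.subsetP => k _; rewrite !inE.
    have [//|ki /=] := eqVneq k i; apply: contraT => kj.
    by exfalso; apply: nk; exists k.
  by rewrite cardsT card_ord cards2 ij leqNgt n3.
exists s; split=> //.
  apply/eqP => s1.
  have sij : dentry s i = dentry s j.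
    have sj : dentry s j != 0 by rewrite gt_eqF ?dentry_gt0.
    by rewrite -[LHS](mulfVK sj) -/(troot i j s) s1 mul1r.
  apply: (@stabilizer_no_mixed_multiplicity R n Y y s i j k) => // p pk.
  have wk : w k = k by rewrite /w (negPf ki).
  have : w p != w k.
    rewrite wk /w; case: ifP => _; first by rewrite -(inj_eq val_inj) eq_sym in kj.
    by rewrite -(inj_eq val_inj) in pk.
  by case: ltngtP => // H _; [rewrite eq_sym|]; exact: sep.
rewrite sE wij subrr !mulr0 expr0z mulr1.
have := b1 i; have := b1 j; have := dentry_gt0 b i.
move: (dentry b i) (dentry b j) => bi bj bi0.
rewrite !ltr_distl => /andP[j1 j2] /andP[i1 i2].
rewrite ltr_pdivrMr// ltr_pdivlMr//.
apply/andP; split; nra.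
Qed.

Lemma stabilizerX s y m : act s y = y -> act (s ^+ m)%g y = y.
Proof.
by move=> sy; elim: m => [|m IH]; rewrite ?expg0 ?diagA_act1// expgS diagA_actM IH.
Qed.

Lemma stabilizerV s y : act s y = y -> act s^-1%g y = y.
Proof. by move=> sy; rewrite -{1}sy -diagA_actM mulVg diagA_act1. Qed.

(** The powers of a stabilizer element with root value slightly above [1] are
    closely spaced. *)
Lemma stabilizer_root_dense Y y (i j : 'I_n) (r eta : R) : (3 <= n)%N ->
  compact_A_minimal Y -> Y = orbit_of act setT y -> i != j -> 0 < r -> 0 < eta ->
  exists2 s, act s y = y & `|troot i j s - r| < eta.
Proof.
move=> n3 Ymin YE ij r0 eta0.
pose e := Num.min 2^-1 (eta / (2 * r)).
have e0 : 0 < e by rewrite lt_min invr_gt0 ltr0n divr_gt0// mulr_gt0.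
have [s [sy s1 sE]] : exists s, [/\ act s y = y, 1 < troot i j s &
    troot i j s - 1 < eta / r].
  have [s [sy s1 se]] := stabilizer_root_near1 n3 Ymin YE ij e0.
  have e2 : e <= 2^-1 by rewrite ge_min lexx.
  have er : e <= eta / r / 2.
    rewrite ge_min (_ : eta / r / 2 = eta / (2 * r)) ?lexx ?orbT//.
    by field; rewrite gt_eqF.
  have r0' := troot_gt0 i j s.
  have er0 : 0 < eta / r by rewrite divr_gt0.
  move: se; rewrite ltr_distl => /andP[lo hi].
  have [s1'|s1'|s1'] := ltgtP (troot i j s) 1.
  - exists s^-1%g; split; first exact: stabilizerV.
      by rewrite trootV invf_gt1.
    rewrite trootV ltrBlDr invf_plt ?posrE//; last by rewrite addr_gt0.
    rewrite -div1r ltr_pdivrMr ?addr_gt0//; nra.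
  - by exists s; split=> //; lra.
  - by rewrite s1' eqxx in s1.
have [k /andP[k1 k2]] := expz_between s1 r0.
have [t ty tE] : exists2 t, act t y = y & troot i j t = troot i j s ^ k.
  case: k {k1 k2} => m; first by exists (s ^+ m)%g; [exact: stabilizerX|exact: trootX].
  exists (s ^+ m.+1)^-1%g; first by apply/stabilizerV/stabilizerX.
  by rewrite trootV trootX.
exists t => //; rewrite tE distrC ger0_norm ?subr_ge0//.
have sr0 := troot_gt0 i j s.
rewrite expfzDr ?gt_eqF// expr1z in k2.
move: sE; rewrite [_ < eta / r]ltr_pdivlMr// => sE.
set v := troot i j s in s1 sE k1 k2 *; set u := v ^ k in k1 k2 *.
have : 0 <= (r - u) * (v - 1) by apply: mulr_ge0; rewrite subr_ge0// ltW.
lra.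
Qed.

End StabilizerRoots.

(** * The implications *)

Section Equivalences.
Local Open Scope ring_scope.
Context {R : realType} {n : nat}.
Local Notation G := (SL R n).
Local Notation X := (SL_mod_SLZ R n).
Local Notation act := (@diagA_act R n).
Implicit Types (g h : G) (x y : X) (K Y : set X) (a b s : diagA R n).

Lemma is_root_troot (i j : 'I_n) : i != j -> is_root (@troot R n i j).
Proof.
move=> ij; split.
- exact: troot_gt0.
- exact: trootM.
- have [a aE] := exists_dyadic_root (R := R) (fun p => (p == i)%:Z).
  exists a; rewrite aE eqxx [j == i]eq_sym (negPf ij) subr0 mulr1 -exprnP.
  have n0 : (0 < n)%N by apply: leq_ltn_trans (ltn_ord i).
  by rewrite gt_eqF// exprn_egt1 ?ltr1n// -lt0n.
exists (delta_mx i j); split.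
- by apply/eqP => /matrixP/(_ i j)/eqP; rewrite !mxE !eqxx oner_eq0.
- rewrite /mxtrace big1// => p _; rewrite mxE.
  by have [->|//] := eqVneq p i; rewrite (negPf ij).
move=> a; apply/matrixP => p q.
rewrite /Ad (_ : (diagA_val a)^-1%g = diagA_val a^-1%g)// !diagA_mx.
rewrite mul_diag_mx mul_mx_diag !mxE dentryV.
by case: andP => [[/eqP -> /eqP ->]|_]; rewrite ?mulr1 // !mulr0 mul0r.
Qed.

Lemma is_rootP (alpha : diagA R n -> R) : is_root alpha ->
  exists i j : 'I_n, i != j /\ alpha = @troot R n i j.
Proof.
move=> [_ _ [a0 a0E] [v [v0 _ vE]]].
have [i [j vij]] : exists i j, v i j != 0.
  apply: contrapT => nv; move/negP: v0; apply; apply/eqP/matrixP => i j.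
  rewrite mxE; apply/eqP; apply: contraT => vij.
  by exfalso; apply: nv; exists i, j.
have aE : alpha = @troot R n i j.
  apply/funext => a; have := vE a.
  rewrite /Ad (_ : (diagA_val a)^-1%g = diagA_val a^-1%g)// !diagA_mx.
  rewrite mul_diag_mx mul_mx_diag => /matrixP/(_ i j); rewrite !mxE dentryV.
  by rewrite mulrAC => /(mulIf vij).
exists i, j; split=> //; apply: contraNneq a0E => ij.
have d0 : dentry a0 j != 0 by rewrite gt_eqF ?dentry_gt0.
by rewrite aE ij /troot divff.
Qed.

Lemma root_ker1 (i j : 'I_n) : root_ker (@troot R n i j) 1%g.
Proof. exact: troot1. Qed.

Lemma root_kerM (i j : 'I_n) a b : root_ker (@troot R n i j) a ->
  root_ker (@troot R n i j) b -> root_ker (@troot R n i j) (a * b)%g.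
Proof. by rewrite /root_ker /= trootM => -> ->; rewrite mulr1. Qed.

Lemma orbit_invariant x : A_invariant (orbit_of act setT x).
Proof. by move=> a _ [b _ <-]; exists (a * b)%g => //; rewrite diagA_actM. Qed.

(** As root values on the stabilizer of [z] are dense, any [b] in [A] can be
    multiplied by a stabilizer element so as to be near the kernel of the root,
    without changing the image of [z]. *)
Lemma compact_orbit_root_minimal Y y (i j : 'I_n) : (3 <= n)%N ->
  compact_A_minimal Y -> Y = orbit_of act setT y -> i != j ->
  minimal_set act (root_ker (@troot R n i j)) Y.
Proof.
move=> n3 Ymin YE ij; have [_ [Y0 Ycl YA _]] := Ymin.
split=> // [a x _|z Yz x Yx]; first exact: YA.
have YEz : Y = orbit_of act setT z.
  by rewrite YE; apply: orbit_eq; rewrite -YE.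
move: Yx; rewrite YEz => -[b _ <-]; apply/closure_translateP => e e0.
pose d := Num.min 2^-1 (e / 2).
have d0 : 0 < d by rewrite lt_min invr_gt0 ltr0n divr_gt0.
have b0 := troot_gt0 i j b.
have db0 : 0 < d * troot i j b by rewrite mulr_gt0.
have [s sz sE] := stabilizer_root_dense n3 Ymin YEz ij b0 db0.
pose v := troot i j s / troot i j b.
have v0 : 0 < v by rewrite divr_gt0 ?troot_gt0.
have vd : `|v - 1| < d.
  rewrite (_ : v - 1 = (troot i j s - troot i j b) / troot i j b); last first.
    by rewrite /v; field; rewrite gt_eqF.
  by rewrite normrM normfV (gtr0_norm b0) ltr_pdivrMr.
pose r := Num.sqrt v.
have r0 : 0 < r by rewrite sqrtr_gt0.
have rE : r * r = v by rewrite -expr2 sqr_sqrtr// ltW.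
(* The root takes the value [r * r = v] on [c], which corrects [b * s^-1] to an
   element of the kernel. *)
have [c cE] : exists c : diagA R n, forall p,
    dentry c p = if p == i then r else if p == j then r^-1 else 1.
  apply: exists_diag => [p|].
    by case: ifP => // _; case: ifP => // _; rewrite invr_gt0.
  rewrite (bigD1 i)//= eqxx (bigD1 j)/= 1?eq_sym// eqxx (negPf ij).
  rewrite mulrA divff ?gt_eqF// mul1r big1// => p /andP[pi pj].
  by rewrite (negPf pi) (negPf pj).
exists (diagA_val c).
  apply/mx_norm_ltP => // p q; rewrite diagA_mx !mxE.
  have [_|_] := eqVneq p q; last by rewrite mulr0n subrr normr0.
  have d2 : d <= 2^-1 by rewrite ge_min lexx.
  have de : d <= e / 2 by rewrite ge_min lexx orbT.
  have : `|r - 1| < d.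
    apply: le_lt_trans vd; rewrite -rE (_ : r * r - 1 = (r - 1) * (r + 1)).
      by rewrite normrM ler_peMr// ger0_norm ?lerDr ?addr_ge0// ltW.
    by ring.
  rewrite ltr_distl => /andP[r1 r2].
  have er : 0 < e * (r - 2^-1) by rewrite mulr_gt0// subr_gt0; lra.
  rewrite !mulr1n cE; case: ifP => _; [|case: ifP => _; last by rewrite subrr normr0].
    by rewrite ltr_distl; apply/andP; split; lra.
  rewrite ltr_distl; apply/andP; split.
    by rewrite -div1r ltr_pdivlMr//; lra.
  by rewrite -div1r ltr_pdivrMr//; lra.
exists (c * b * s^-1)%g.
  rewrite /root_ker/= !trootM trootV {1}/troot !cE eqxx [j == i]eq_sym (negPf ij) eqxx.
  rewrite invrK rE /v; field; rewrite !gt_eqF ?troot_gt0//.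
by rewrite !diagA_actM (stabilizerV sz).
Qed.

(** The kernel of the root commutes with [A] and with the shears, so such an
    element maps orbit closures of the kernel to orbit closures. *)
Lemma root_minimal_stable (Y0 : set X) (i j : 'I_n) (ij : i != j) a t z z' :
  minimal_set act (root_ker (@troot R n i j)) Y0 -> Y0 z -> Y0 z' ->
  Y0 (translate (diagA_val a * transvection ij t)%g z) ->
  Y0 (translate (diagA_val a * transvection ij t)%g z').
Proof.
move=> [_ Ycl Yinv Ymin] Yz Yz'; set h := (_ * _)%g => Yhz.
apply/Ycl/closure_translateP => e e0.
have [d d0 dh] := near1_conj h e0.
have /closure_translateP /(_ d d0) [k kd [c cker ck]] := Ymin _ Yz _ Yz'.
exists (h * k * h^-1)%g; first exact: dh.
rewrite -translateM mulgVK translateM -ck.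
rewrite -[act c z]/(translate (diagA_val c) z) -translateM.
have ac : (diagA_val a * diagA_val c = diagA_val c * diagA_val a)%g.
  by apply: val_inj; rewrite /= !diagA_mx diag_mxC.
have uc : (transvection ij t * diagA_val c = diagA_val c * transvection ij t)%g.
  have := transvection_conj ij c t; rewrite cker mul1r => E.
  by rewrite -{1}E mulgVK.
have hc : (h * diagA_val c = diagA_val c * h)%g.
  by rewrite /h -mulgA uc mulgA ac mulgA.
by rewrite hc translateM; apply: (Yinv c).
Qed.

(** Some point of any orbit in [Y] is near [y], hence on the orbit of [y]. *)
Lemma isolated_minimal_set_orbit Y :
  compact_A_minimal Y ->
  (exists2 e : R, 0 < e & forall h z, near1 e h -> Y z -> Y (translate h z) ->
    h \in @pos_diag R n) ->
  exists y, Y = orbit_of act setT y.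
Proof.
move=> [_ [[y Yy] _ YA Ymin]] [e e0 iso]; exists y.
apply/seteqP; split=> [z Yz|_ [a _ <-]]; last exact: YA.
have /closure_translateP /(_ e e0) [h hn [a _ ha]] := Ymin _ Yz _ Yy.
have hA : h \in @pos_diag R n.
  by apply: (iso h y hn Yy); rewrite -ha; exact: YA.
exists (a^-1 * MkDiagA hA)%g => //; rewrite diagA_actM.
by rewrite -[act (MkDiagA hA) y]/(translate h y) -ha -diagA_actM mulVg diagA_act1.
Qed.

(** Otherwise a shear would move a point of [Y] within [Y]; [no_shear_return]
    excludes it, with [Y0] minimal for the kernel of the corresponding root. *)
Lemma root_minimal_spread_orbit Y :
  compact_A_minimal Y ->
  (forall alpha, is_root alpha -> exists Ya : set X, [/\ Ya `<=` Y,
     minimal_set act (root_ker alpha) Ya &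
     [set act a y | a in [set: diagA R n] & y in Ya] = Y]) ->
  exists y, Y = orbit_of act setT y.
Proof.
move=> Ymin Hd; have [Yc [_ Ycl YA _]] := Ymin.
have YI : A_invariant Y by move=> a x; exact: YA.
apply: isolated_minimal_set_orbit => //; apply: contrapT => noe.
have [e e0|i [j [ij [t [z [t0 Yz Yt]]]]]] :=
    @transverse_return_shear R n Y Y Yc Ycl YI YI.
  apply: contrapT => nh; apply: noe; exists e => // h z hn Yz Yh.
  by apply: contrapT => /negP hA; apply: nh; exists h, z.
have [Ya [YaY Yamin AYa]] := Hd _ (is_root_troot ij).
apply: (@no_shear_return R n Y Ya i j ij Ymin YaY) Yt => //.
- by move=> y; rewrite -AYa => -[a _ [x Yax <-]]; exists a, x.
- by move=> a u z1 z2 Yz1 Yz2; exact: root_minimal_stable.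
Qed.

(** A bounded orbit accumulates on a compact orbit [Y].  Unless it is [Y], its
    closure contains a shear of a point of [Y]; the stabilizer of this point,
    on which root values are dense, spreads it to a whole ray of shears. *)
Lemma bounded_orbit_closed x : (3 <= n)%N ->
  (forall Y, compact_A_minimal Y -> exists y, Y = orbit_of act setT y) ->
  compact (closure (orbit_of act setT x)) ->
  closed (orbit_of act setT x) /\ compact (orbit_of act setT x).
Proof.
move=> n3 Ha; set K := closure _ => Kc.
have Kcl : closed K by exact: closed_closure.
have KI : A_invariant K.
  by move=> a; apply: (@closure_stable _ _ _ (diagA_val a)); exact: orbit_invariant.
have [Y YK Ym] : exists2 Y, Y `<=` K & minimal_set act setT Y.
  apply: exists_minimal_set => // [|a y _]; last exact: KI.
  by exists x; apply: subset_closure; exact: orbit_self.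
have [_ Ycl YA _] := Ym.
have Ymin : compact_A_minimal Y by split=> //; exact: subclosed_compact Ycl Kc YK.
have Yc : compact Y by case: Ymin.
have YI : A_invariant Y by move=> a z; exact: YA.
have [y YE] := Ha _ Ymin.
suff xY : Y x.
  have <- : Y = orbit_of act setT x by rewrite YE; apply: orbit_eq; rewrite -YE.
  by [].
have Yy : Y y by rewrite YE; exact: orbit_self.
apply: contrapT => nYx.
have [e e0|i [j [ij [t [z [t0 Yz Kt]]]]]] :=
    @transverse_return_shear R n K Y Yc Kcl KI YI.
  have /closure_translateP /(_ e e0) [h hn [a _ ha]] := YK _ Yy.
  exists h, y; split=> //; last first.
    by rewrite -ha; apply: KI; apply: subset_closure; exact: orbit_self.
  apply/negP => hA; apply: nYx.
  rewrite -[x](diagA_act1) -(mulVg a) diagA_actM ha.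
  by apply: (YI _ _); apply: (YI (MkDiagA hA)).
apply: (@shear_ray_escapes _ _ K z i j ij t) => //; first exact: YK.
move=> r r0; apply: closed_translate => // e e0.
have YEz : Y = orbit_of act setT z.
  by rewrite YE; apply: orbit_eq; rewrite -YE.
have et0 : 0 < e / `|t| by rewrite divr_gt0 ?normr_gt0.
have [s sz sr] := stabilizer_root_dense n3 Ymin YEz ij r0 et0.
exists (transvection ij (troot i j s * t)).
  apply: le_lt_trans (transvection_near _ _ _) _.
  by rewrite -mulrBl normrM -ltr_pdivlMr ?normr_gt0.
rewrite -transvection_conj !translateM -[translate _ z]/(act s^-1%g z).
by rewrite (stabilizerV sz); exact: (KI s).
Qed.

End Equivalences.

Theorem theorem2 (R : realType) (n : nat) (n_ge3 : (3 <= n)%N) :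
  [<->
    (* M *)
    forall x : SL_mod_SLZ R n,
      compact (closure (orbit_of (@diagA_act R n) setT x)) ->
      closed (orbit_of (@diagA_act R n) setT x) /\
      compact (orbit_of (@diagA_act R n) setT x);
    (* a *)
    forall Y : set (SL_mod_SLZ R n), compact_A_minimal Y ->
      exists x, Y = orbit_of (@diagA_act R n) setT x;
    (* b *)
    forall alpha, is_root alpha ->
    forall Y : set (SL_mod_SLZ R n), compact_A_minimal Y ->
      minimal_set (@diagA_act R n) (root_ker alpha) Y;
    (* c *)
    forall alpha, is_root alpha ->
    forall Y : set (SL_mod_SLZ R n), compact_A_minimal Y ->
    forall Ya : set (SL_mod_SLZ R n), Ya `<=` Y ->
      minimal_set (@diagA_act R n) (root_ker alpha) Ya ->
      [set diagA_act a y | a in [set: diagA R n] & y in Ya] = Y;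
    (* d *)
    forall alpha, is_root alpha ->
    forall Y : set (SL_mod_SLZ R n), compact_A_minimal Y ->
    exists Ya : set (SL_mod_SLZ R n),
      [/\ Ya `<=` Y,
          minimal_set (@diagA_act R n) (root_ker alpha) Ya &
          [set diagA_act a y | a in [set: diagA R n] & y in Ya] = Y]
  ].
Proof.
tfae.
- move=> HM Y [Yc [[x Yx] Ycl YA Ymin]]; exists x.
  have oY : orbit_of (@diagA_act R n) setT x `<=` Y by move=> _ [a _ <-]; exact: YA.
  have coY : closure (orbit_of (@diagA_act R n) setT x) `<=` Y.
    by apply: subset_trans (closureS oY) _; exact: Ycl.
  have [ocl _] := HM x (subclosed_compact (@closed_closure _ _) Yc coY).
  by apply/seteqP; split=> // y /(Ymin _ Yx) /ocl.
- move=> Ha _ /is_rootP[i [j [ij ->]]] Y Ymin; have [y YE] := Ha _ Ymin.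
  exact: compact_orbit_root_minimal YE ij.
- move=> Hb alpha ar Y Ymin Ya YaY [[y Yay] Yacl Yainv _].
  have [_ _ _ Ydense] := Hb _ ar _ Ymin; have [_ [_ _ YA _]] := Ymin.
  have YYa : Y `<=` Ya.
    move=> z /(Ydense _ (YaY _ Yay)) zcl; apply: Yacl; apply: closureS zcl.
    by move=> _ [a aker <-]; exact: Yainv.
  apply/seteqP; split=> [_ [a _ [z /YaY Yz <-]]|z /YYa Yaz]; first exact: YA.
  by exists 1%g => //; exists z => //; apply: diagA_act1.
- move=> Hc alpha ar Y Ymin; have [Yc [Y0 Ycl YA _]] := Ymin.
  have [i [j [ij aE]]] := is_rootP ar.
  have [||||||Ya YaY Yamin] := @exists_minimal_set R n (root_ker alpha) Y => //.
  + by rewrite aE; exact: root_ker1.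
  + by rewrite aE; exact: root_kerM.
  + by move=> a x _; exact: YA.
  by exists Ya; split=> //; exact: (Hc alpha ar Y Ymin Ya YaY Yamin).
move=> Hd x; apply: bounded_orbit_closed n_ge3 _ => Y Ymin.
by apply: root_minimal_spread_orbit => // alpha /Hd; exact.
Qed.
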